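(* Let $n\ge 3$ be an integer and let $m$ be a rational integer with $m\neq 0,\pm1$ such that $F(x)=x^n-m\in\mathbb{Z}[x]$ is irreducible over $\mathbb{Q}$. Let $K=\mathbb{Q}(\alpha)$ where $\alpha$ is a root of $F(x)$. Assume that $n=u\cdot p^r$, where $u$ is a positive integer, $r$ is a nonnegative integer, and $p$ is an odd prime not dividing $u\cdot m$. Let $\nu=\nu_p(m^{p-1}-1)$. If $$\min\{r+1,\nu\}\cdot N_p(d,u,m)>N_p(d)$$ for some positive integer $d$, then $K$ is not monogenic.
   Context: For a prime $p$, $\nu_p$ denotes the $p$-adic valuation and $\mathbb{F}_p$ the field with $p$ elements. For a positive integer $d$, $N_p(d)$ is the number of monic irreducible polynomials of degree $d$ in $\mathbb{F}_p[x]$, and for positive integers $d,u$, $N_p(d,u,m)$ is the number of distinct monic irreducible factors of degree $d$ of the polynomial $x^u-\overline{m}$ in $\mathbb{F}_p[x]$. A number field $K$ with ring of integers $\mathbb{Z}_K$ is monogenic if there is $\theta\in\mathbb{Z}_K$ such that $\{1,\theta,\dots,\theta^{[K:\mathbb{Q}]-1}\}$ is a $\mathbb{Z}$-basis of $\mathbb{Z}_K$. *)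

(* Defs.v *)
From HB Require Import structures.
From mathcomp Require Import all_boot all_order all_algebra all_field.
From mathcomp Require Import boolp.
Set Implicit Arguments. Unset Strict Implicit. Unset Printing Implicit Defensive.
Import GRing.Theory Num.Theory.
Local Open Scope ring_scope.

Definition monic_of (p d : nat) (c : {ffun 'I_d -> 'F_p}) : {poly 'F_p} :=
  'X^d + \sum_(i < d) (c i)%:P * 'X^i.

Definition Np (p d : nat) : nat :=
  #|[set c : {ffun 'I_d -> 'F_p} | `[< irreducible_poly (monic_of c) >] ]|.

Definition Npum (p d u : nat) (m : int) : nat :=
  #|[set c : {ffun 'I_d -> 'F_p} | `[< irreducible_poly (monic_of c) >]
        && (monic_of c %| 'X^u - ((m%:~R : 'F_p)%:P))]|.

Definition nu_p (p : nat) (z : int) : nat := logn p `|z|%N.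

Definition QQadj (alpha : algC) : {pred algC} :=
  fun x => `[< exists q : {poly rat}, x = (map_poly ratr q).[alpha] >].

Definition ZK (alpha : algC) : {pred algC} :=
  fun x => (x \in QQadj alpha) && (x \in Aint).

(* Monogenic: there is theta in Z_K such that {1, theta, ..., theta^(k-1)}
   is a Z-basis of Z_K (k is then necessarily [K:Q]). *)
Definition monogenic (alpha : algC) : Prop :=
  exists (theta : algC) (k : nat),
    [/\ theta \in ZK alpha,
        (forall x, x \in ZK alpha ->
           exists c : 'I_k -> int, x = \sum_(i < k) (c i)%:~R * theta ^+ i) &
        (forall c : 'I_k -> int,
           \sum_(i < k) (c i)%:~R * theta ^+ i = 0 -> forall i, c i = 0)].

(* Main.v *)
Require Import Defs.
From HB Require Import structures.
From mathcomp Require Import all_boot all_order all_algebra all_field.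
From mathcomp Require Import boolp.
From mathcomp Require Import ring zify.
Set Implicit Arguments. Unset Strict Implicit. Unset Printing Implicit Defensive.
Import GRing.Theory Num.Theory.
Local Open Scope ring_scope.

(* Put [M = m^(p-1)], [s + 1 = min(r + 1, nu)], [t = alpha^(u(p-1))] and [z_k = t^(p^(r-k))], so that
   [z_k^(p^k) = M] and [p^(s+1) | M - 1].  For [k <= s] the element
   [h_k = (M - 1) / (p^k (z_k - 1))] is an algebraic integer which is [0] or [1] modulo every
   prime above [p], and [h_k = 0] forces [h_(k+1) = 0].  For an irreducible factor [f] of [X^u - m]
   over [F_p] and [k <= s], consider the primes [P] with [f(alpha^(p^r)) = 0], [h_k = 1] and
   (if [k < s]) [h_(k+1) = 0] modulo [P].  A trace computation shows that there is one; its residue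
   field contains a root of [f], and [t - 1] shows that its ramification index is at least
   [e_k = (p-1)p^(r-k-1)] for [k < s] and [e_s = p^(r-s)].  As [sum_(f,k) e_k deg f = n], these primes
   have residue degree exactly [deg f].  Hence there are at least [(s + 1) N_p(d,u,m)] primes
   of residue degree [d], whereas a generator [theta] of the ring of integers, with minimal
   polynomial [G], makes the primes above [p] correspond to irreducible factors of [G] modulo [p],
   of which at most [N_p(d)] have degree [d]. *)

(** * Congruences for [p]-th powers in a subring *)

Section PrimePowers.

Variables (R : comNzRingType) (S : subringClosed R) (p : nat).
Hypothesis pr_p : prime p.

(** The middle binomial coefficients are divisible by [p] and the middle monomials by [x * y]. The
    cofactor is kept in [S], so that the congruence holds in [S] itself. *)
Lemma exprD_prime_in (x y : R) : x \in S -> y \in S ->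
  exists2 z, z \in S & (x + y) ^+ p = x ^+ p + y ^+ p + p%:R * (x * y * z).
Proof.
move=> xS yS; have := pr_p; case: p pr_p => [|[|q]] // pr_q _.
exists (\sum_(i < q.+1) (x ^+ (q - i) * y ^+ i) *+ ('C(q.+2, i.+1) %/ q.+2)).
  by apply: rpred_sum => i _; rewrite rpredMn ?rpredM ?rpredX.
rewrite exprDn big_ord_recl big_ord_recr /= subn0 bin0 binn subnn !expr0 mulr1 mul1r.
rewrite !mulr1n /bump /= !add1n [X in _ + X]addrC addrA; congr (_ + _).
rewrite !mulr_sumr; apply: eq_bigr => i _.
have ltiq: (i <= q)%N by rewrite -ltnS.
have -> : 'C(q.+2, (0 <= i) + i) = ('C(q.+2, i.+1) %/ q.+2 * q.+2)%N.
  by rewrite add1n divnK // prime_dvd_bin // !ltnS leq0n.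
rewrite subSS add1n subSn // [_ ^+ (q - i).+1]exprS [y ^+ i.+1]exprS.
rewrite mulnK //; move: (_ %/ _)%N (x ^+ _) (y ^+ _) => c v w.
by rewrite mulrnA -[LHS]mulr_natl [x * y * _]mulrnAr mulrACA.
Qed.

(** The linear term is isolated from the other middle terms: after division by [y], the part
    divisible by [p] is [p] times an element congruent to 1 modulo [y]. *)
Lemma expr1D_prime_in (y : R) : (2 < p)%N -> y \in S ->
  exists2 x, x \in S &
    (1 + y) ^+ p = 1 + y ^+ p + p%:R * (y * (1 + y * x)).
Proof.
move=> + yS; have := pr_p; case: p pr_p => [|[|[|q]]] // pr_q _ _.
exists (\sum_(i < q.+1) y ^+ i *+ ('C(q.+3, i.+2) %/ q.+3)).
  by apply: rpred_sum => i _; rewrite rpredMn ?rpredX.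
rewrite exprDn big_ord_recl big_ord_recr big_ord_recl /= bin0 binn !expr0 !expr1n !mul1r.
rewrite !mulr1n /bump /= !add1n bin1 expr1 [X in 1 + X = _]addrC [LHS]addrA; congr (_ + _).
rewrite mulrDr mulrDr !mulr1 mulr_natl; congr (_ + _).
rewrite !mulr_sumr; apply: eq_bigr => i _.
rewrite expr1n mul1r !add1n.
have -> : 'C(q.+3, i.+2) = ('C(q.+3, i.+2) %/ q.+3 * q.+3)%N.
  by rewrite divnK // prime_dvd_bin // !ltnS /=; case: (i).
rewrite mulnK // !exprS; move: (_ %/ _)%N (y ^+ _) => c v.
by rewrite mulrnA -[LHS]mulr_natl !mulrnAr.
Qed.

(** Iterating [exprD_prime_in] keeps the factor [y] in the error term. With [y = t - 1] the error
    divided by [p] therefore still lies in every prime that contains [t - 1]. *)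
Lemma expr1D_primeX_in (y : R) a : y \in S ->
  exists2 x, x \in S &
    (1 + y) ^+ (p ^ a) = 1 + y ^+ (p ^ a) + p%:R * (y * x).
Proof.
move=> yS; elim: a => [|a [x xS IH]].
  by exists 0; rewrite ?rpred0 // expn0 !expr1 !mulr0 addr0.
have pa: (p ^ a = (p ^ a).-1.+1)%N by rewrite prednK ?expn_gt0 ?prime_gt0.
have p1: (p = p.-1.+1)%N by rewrite prednK ?prime_gt0.
set Y := y ^+ (p ^ a).-1 + p%:R * x.
have YS: Y \in S by rewrite rpredD ?rpredX ?rpredM ?rpred_nat.
have eY: 1 + y ^+ (p ^ a) + p%:R * (y * x) = 1 + y * Y.
  by rewrite /Y pa exprS; ring.
have [z zS ez] := exprD_prime_in (rpred1 S) (rpredM yS YS).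
have [w wS ew] : exists2 z, z \in S &
   (y * Y) ^+ p = (y ^+ (p ^ a)) ^+ p + p%:R * (y * z).
  have -> : y * Y = y ^+ (p ^ a) + p%:R * (y * x) by rewrite /Y pa exprS; ring.
  have [||z' z'S ->] := @exprD_prime_in (y ^+ (p ^ a)) (p%:R * (y * x)).
  - by rewrite rpredX.
  - by rewrite !rpredM ?rpred_nat.
  exists (p%:R ^+ p.-1 * y ^+ p.-1 * x ^+ p + y ^+ (p ^ a) * p%:R * x * z').
    by rewrite rpredD ?rpredM ?rpredX ?rpred_nat.
  have -> : (p%:R * (y * x)) ^+ p = p%:R * p%:R ^+ p.-1 * (y * y ^+ p.-1) * x ^+ p.
    by rewrite -!exprS -p1 !exprMn mulrA.
  ring.
exists (w + Y * z); first by rewrite rpredD ?rpredM.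
rewrite expnSr !exprM IH eY ez ew expr1n; ring.
Qed.

End PrimePowers.

(** * Transitivity of integrality for algebraic integers *)

Lemma Aint_integral (x : algC) :
  x \in Aint -> integralOver (intr : int -> algC) x.
Proof.
rewrite unfold_in => /floorpP[q Dq]; exists q.
  have := minCpoly_monic x; rewrite Dq !monicE lead_coef_map_inj ?rmorph0 //.
    by rewrite -[1 in X in X -> _](rmorph1 intr) eqr_int.
  exact: intr_inj.
by rewrite -Dq root_minCpoly.
Qed.

Lemma integral_Aint (x : algC) :
  integralOver (intr : int -> algC) x -> x \in Aint.
Proof.
move=> [q q_mon qx]; apply: root_monic_Aint qx _ _; first exact: monic_map.
by apply/polyOverP => i; rewrite coef_map rpred_int.
Qed.

Lemma root_monic_Aint_Aint (q : {poly algC}) (x : algC) :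
  q \is monic -> root q x -> q \is a polyOver Aint -> x \in Aint.
Proof.
move=> q_mon qx /allP qA; apply: integral_Aint.
by apply: integral_root_monic q_mon qx _ => y /qA/Aint_integral.
Qed.

(** * Irreducible factors over a field *)

Section PolyFactors.

Variable F : fieldType.
Implicit Types f g q : {poly F}.

Lemma irredp_gt1 f : irreducible_poly f -> (1 < size f)%N.
Proof. by case. Qed.

(* In [F[X]/g], of dimension [(size g).-1], the first [size g] powers of [b] are dependent. *)
Lemma dvdp_comp_exists g b : (1 < size g)%N ->
  exists q, [/\ q != 0, (size q <= size g)%N & g %| q \Po b].
Proof.
move=> g_gt1; pose A := \matrix_(i < size g) (poly_rV (b ^+ i %% g) : 'rV_(size g).-1).
have : kermx A != 0.
  rewrite kermx_eq0 /row_free neq_ltn (leq_ltn_trans (rank_leq_col A)) //.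
  by rewrite prednK // ltnW.
case/rowV0Pn => v /sub_kermxP vA v0.
exists (rVpoly v); split; last 1 first.
- have qbE : (rVpoly v \Po b) %% g = \sum_i v 0 i *: (b ^+ i %% g).
    rewrite /rVpoly poly_def rmorph_sum /= (big_morph _ (modpD g) (mod0p g)).
    apply: eq_bigr => i _; rewrite insubT // => lti.
    rewrite linearZ /= comp_Xn_poly modpZl; congr (v _ _ *: _).
    exact: val_inj.
  have sz_mod i : (size (b ^+ i %% g)%R <= (size g).-1)%N.
    by rewrite -ltnS prednK ?ltn_modp -?size_poly_gt0 ltnW.
  apply/modp_eq0P; rewrite qbE.
  rewrite -[RHS](linear0 (rVpoly (d := (size g).-1))) -vA mulmx_sum_row linear_sum /=.
  by apply: eq_bigr => i _; rewrite linearZ /= rowK poly_rV_K.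
- by apply: contra v0 => /eqP q0; rewrite -[v]rVpolyK q0 linear0.
- exact: size_poly.
Qed.

(* [X |-> b] embeds the field [F[X]/f] into [F[X]/g]. *)
Lemma leq_size_irreducible_comp f g b :
  irreducible_poly f -> (1 < size g)%N -> g %| f \Po b -> (size f <= size g)%N.
Proof.
move=> f_irr g_gt1 g_fb; rewrite leqNgt; apply/negP => lt_gf.
have [q [q0 szq g_qb]] := dvdp_comp_exists b g_gt1.
have : coprimep f q.
  rewrite irreducible_poly_coprime //; apply/negP => /(dvdp_leq q0).
  by rewrite leqNgt (leq_ltn_trans szq).
case/Bezout_eq1_coprimepP => -[v w] /= /(congr1 (comp_poly b)).
rewrite comp_polyD !comp_polyM rmorph1 => vw1.
have : g %| 1 by rewrite -vw1 dvdp_add // dvdp_mull.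
by rewrite dvdp1 => /eqP g1; rewrite g1 in g_gt1.
Qed.

Lemma irreducible_divisor q :
  (1 < size q)%N -> exists f, [/\ f \is monic, irreducible_poly f & f %| q].
Proof.
move=> q_gt1.
have [|d] := @ex_minnP (fun d => `[< exists f, [/\ (1 < size f)%N, f %| q & size f = d] >]).
  by exists (size q); apply/asboolP; exists q.
case/asboolP => f [f_gt1 fq szf] d_min.
have lf0 : lead_coef f != 0 by rewrite lead_coef_eq0 -size_poly_gt0 ltnW.
exists ((lead_coef f)^-1 *: f); split.
- by rewrite monicE lead_coefZ mulVf.
- split; first by rewrite size_scale ?invr_neq0.
  move=> h h1; rewrite dvdpZr ?invr_neq0 // => hf.
  have f0 : f != 0 by rewrite -lead_coef_eq0.
  rewrite eqp_sym (eqp_ltrans (eqp_scale _ _)) ?invr_neq0 // eqp_sym -dvdp_size_eqp //.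
  rewrite eqn_leq dvdp_leq // szf d_min //; apply/asboolP; exists h.
  split=> //; last exact: dvdp_trans fq.
  rewrite ltn_neqAle eq_sym h1 size_poly_gt0.
  by apply: contraTneq hf => ->; rewrite dvd0p.
- by rewrite dvdpZl ?invr_neq0.
Qed.

Lemma monic_irreducible_dvdp_eq f g :
  f \is monic -> irreducible_poly f -> g \is monic -> irreducible_poly g ->
  f %| g -> f = g.
Proof.
move=> f_mon f_irr g_mon [_ g_irr] fg; apply/eqP; rewrite -eqp_monic //.
by apply: g_irr => //; rewrite neq_ltn irredp_gt1 ?orbT.
Qed.

(** One irreducible factor of [q] is peeled off against each factor [h]; [size q] is a crude bound
    for the number of these factors. *)
Lemma dvdp_exp_size q h : q != 0 ->
  (forall f, f \is monic -> irreducible_poly f -> f %| q -> f %| h) ->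
  q %| h ^+ size q.
Proof.
have [n] := ubnP (size q); elim: n q => // n IHn q szq q0 qh.
have [q_le1 | q_gt1] := leqP (size q) 1.
  suff /eqP q1 : size q == 1 by rewrite (dvdp_trans _ (dvd1p _)) // dvdp1 q1.
  by rewrite eqn_leq q_le1 size_poly_gt0.
have [f [f_mon f_irr fq]] := irreducible_divisor q_gt1.
have /dvdpP[q' Dq] := fq.
have q'0 : q' != 0 by apply: contraNneq q0 => q'0; rewrite Dq q'0 mul0r.
have szE : size q = (size q' + size f).-1 by rewrite Dq size_mul // (monic_neq0 f_mon).
have f_gt1 := irredp_gt1 f_irr.
have q'_gt0 : (0 < size q')%N by rewrite size_poly_gt0.
have : q %| h ^+ (size q').+1.
  rewrite Dq exprSr dvdp_mul ?qh // IHn //; first by move: szq; rewrite szE; lia.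
  by move=> f' f'_mon f'_irr f'q'; apply: qh => //; rewrite Dq dvdp_mulr.
move/dvdp_trans; apply; apply: dvdp_exp2l; move: szE f_gt1; lia.
Qed.

Lemma separable_factorization q :
  q \is monic -> separable_poly q ->
  exists s : seq {poly F},
    [/\ uniq s, {in s, forall f, f \is monic /\ irreducible_poly f} &
        q = \prod_(f <- s) f].
Proof.
have [n] := ubnP (size q); elim: n q => // n IHn q szq q_mon q_sep.
have [q_le1 | q_gt1] := leqP (size q) 1.
  exists [::]; split=> //; rewrite big_nil.
  by have /eqP := q_mon; rewrite (size1_polyC q_le1) lead_coefC => ->.
have [f [f_mon f_irr /dvdpP[q' Dq]]] := irreducible_divisor q_gt1.
have q'_mon : q' \is monic by rewrite -(monicMr _ f_mon) -Dq.
move: q_sep; rewrite Dq separable_mul => /and3P[q'_sep _ q'f].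
have [|s [s_uniq s_irr Dq']] := IHn q' _ q'_mon q'_sep.
  have f_gt1 := irredp_gt1 f_irr.
  have := size_monicM q'_mon (monic_neq0 f_mon); rewrite -Dq.
  have : size q' != 0%N by rewrite size_poly_eq0 monic_neq0.
  lia.
exists (f :: s); split=> /=; last by rewrite big_cons mulrC Dq'.
  rewrite s_uniq andbT; apply: contraL q'f => fs.
  rewrite coprimep_sym irreducible_poly_coprime // negbK Dq'.
  by rewrite (big_rem f) //= dvdp_mulr.
by move=> g; rewrite inE => /predU1P[-> | /s_irr].
Qed.

Lemma separable_Xn_subC n (a : F) :
  n%:R != 0 :> F -> a != 0 -> separable_poly ('X^n - a%:P).
Proof.
case: n => [|n n0 a0]; first by rewrite eqxx.
rewrite separable_poly.unlock derivB derivC subr0 derivXn.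
(* Euler's relation: [X] times the derivative is [n X^n], so [X (X^n)' / n - (X^n - a) = a]; both
   sides are divided by [a]. *)
apply/Bezout_eq1_coprimepP; exists ((- a^-1)%:P, (a^-1 / n.+1%:R) *: 'X) => /=.
rewrite -scaler_nat -scalerAl -scalerAr scalerA divfK // -exprS mul_polyC scalerBr.
by rewrite scaleNr scaleNr opprK addrAC addNr add0r -mul_polyC -polyCM mulVf.
Qed.

Lemma dvdp_prod_irreducibleX (I : eqType) (s : seq I) (g : I -> {poly F}) (e : I -> nat) q :
  uniq s -> {in s &, injective g} ->
  {in s, forall i, [/\ g i \is monic, irreducible_poly (g i) & g i ^+ e i %| q]} ->
  \prod_(i <- s) g i ^+ e i %| q.
Proof.
elim: s => [|i s IHs] /=; first by rewrite big_nil dvd1p.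
case/andP => i_s s_uniq g_inj gP; rewrite big_cons.
have [gi_mon gi_irr gi_q] := gP i (mem_head _ _).
have sub_s : {subset s <= i :: s} by move=> j; rewrite inE orbC => ->.
rewrite Gauss_dvdp; last first.
  apply: coprimep_expl; rewrite big_seq.
  apply: (big_rec (coprimep (g i))) => [|j h js ch]; first exact: coprimep1.
  rewrite coprimepMr ch andbT coprimep_expr //.
  have [gj_mon gj_irr _] := gP j (sub_s j js).
  rewrite irreducible_poly_coprime //; apply: contraNN i_s.
  move/(monic_irreducible_dvdp_eq gi_mon gi_irr gj_mon gj_irr).
  by move/(g_inj i j (mem_head _ _) (sub_s j js)) ->.
rewrite gi_q IHs // => [j k js ks|j /sub_s]; last exact: gP.
by apply: g_inj; apply: sub_s.
Qed.

End PolyFactors.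

(** * Integers of [Q(alpha)] and their primes *)

Lemma QQadjP alpha x :
  reflect (exists q : {poly rat}, x = (map_poly ratr q).[alpha]) (x \in QQadj alpha).
Proof. exact: asboolP. Qed.

Lemma QQadj_subring alpha : subring_closed (QQadj alpha).
Proof.
split.
- by apply/QQadjP; exists 1; rewrite rmorph1 hornerC.
- move=> x y /QQadjP[q ->] /QQadjP[q' ->]; apply/QQadjP; exists (q - q').
  by rewrite rmorphB /= hornerD hornerN.
- move=> x y /QQadjP[q ->] /QQadjP[q' ->]; apply/QQadjP; exists (q * q').
  by rewrite rmorphM /= hornerM.
Qed.

Lemma ZK_subring alpha : subring_closed (ZK alpha).
Proof.
have [Q1 QB QM] := QQadj_subring alpha; have [A1 AB AM] := Aint_subring.
split.
- by rewrite unfold_in Q1 A1.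
- by move=> x y /andP[xQ xA] /andP[yQ yA]; rewrite unfold_in QB ?AB.
- by move=> x y /andP[xQ xA] /andP[yQ yA]; rewrite unfold_in QM ?AM.
Qed.

HB.instance Definition _ alpha :=
  GRing.isSubringClosed.Build algC (QQadj alpha) (QQadj_subring alpha).
HB.instance Definition _ alpha :=
  GRing.isSubringClosed.Build algC (ZK alpha) (ZK_subring alpha).

(** A prime ideal of [S] containing [p], kept as a bare predicate on [algC]. No quotient ring is
    formed: congruences modulo [P] are statements [P (x - y)]. *)
Record prime_over (S : {pred algC}) (p : nat) (P : algC -> Prop) := PrimeOver {
  prime_overD : forall x y, P x -> P y -> P (x + y);
  prime_overM : forall x y, x \in S -> P y -> P (x * y);
  prime_over_prime : forall x y, x \in S -> y \in S -> P (x * y) -> P x \/ P y;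
  prime_over1 : ~ P 1;
  prime_over_p : P p%:R
}.

Section PrimeOver.

Variables (S : subringClosed algC) (p : nat) (P : algC -> Prop).
Hypothesis PP : prime_over S p P.

Lemma prime_overB x y : P x -> P y -> P (x - y).
Proof.
move=> Px Py; apply: (prime_overD PP) => //; rewrite -mulN1r.
by apply: (prime_overM PP) => //; rewrite rpredN1.
Qed.

Lemma prime_over_mod x y : P (x - y) -> P x <-> P y.
Proof.
move=> Pxy; split=> [Px | Py].
  by rewrite -[y](subKr x); apply: prime_overB.
by rewrite -[x](subrK y); apply: (prime_overD PP).
Qed.

Lemma prime_over_pM x : x \in S -> P (p%:R * x).
Proof. by move=> xS; rewrite mulrC; apply: (prime_overM PP) (prime_over_p PP). Qed.

Lemma prime_overX x n : x \in S -> P (x ^+ n) -> P x.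
Proof.
move=> xS; elim: n => [/(prime_over1 PP) | n IHn] //.
by rewrite exprS => /(prime_over_prime PP xS (rpredX n xS))[].
Qed.

Lemma prime_over_exp x n : x \in S -> (0 < n)%N -> P x -> P (x ^+ n).
Proof. by case: n => // n xS _ Px; rewrite exprSr; apply: (prime_overM PP); rewrite ?rpredX. Qed.

Lemma prime_over_int (c : int) : prime p -> P c%:~R -> (p %| c)%Z.
Proof.
move=> pr_p Pc; apply/negPn/negP => p_c; apply: (prime_over1 PP).
have cop : coprimez p c.
  by rewrite coprimezE /= prime_coprime //.
have [a [b ab]] := Bezoutz p c; move: ab; rewrite (eqP cop).
move/(congr1 (intr : int -> algC)); rewrite rmorphD !rmorphM /= => ab; have {ab}<- : _ = 1 := ab.
apply: (prime_overD PP); apply: (prime_overM PP) => //; rewrite ?rpred_int //.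
exact: (prime_over_p PP).
Qed.

End PrimeOver.

(** * Conjugation over the rationals and Frobenius on sums *)

Section RationalConjugates.

Variables (F : {poly rat}) (alpha : algC).
Hypotheses (F_irr : irreducible_poly F) (Fa : root (map_poly ratr F) alpha).

Lemma irreducible_root_dvdp (q : {poly rat}) :
  root (map_poly ratr q) alpha -> F %| q.
Proof.
move=> qa; apply/negPn; rewrite -irreducible_poly_coprime //.
apply/negP => /Bezout_eq1_coprimepP[[a b] /= /(congr1 (map_poly (ratr : rat -> algC)))].
rewrite rmorphD !rmorphM /= rmorph1 => /(congr1 (horner_eval alpha)) /=.
rewrite /horner_eval hornerD !hornerM (rootP Fa) (rootP qa) !mulr0 addr0 hornerC.
by move/eqP; rewrite eq_sym oner_eq0.
Qed.

Lemma root_conj (q : {poly rat}) (alpha' : algC) :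
  root (map_poly ratr F) alpha' -> root (map_poly ratr q) alpha ->
  root (map_poly ratr q) alpha'.
Proof.
move=> Fa' /irreducible_root_dvdp/dvdpP[q' ->].
by rewrite rmorphM /= rootM Fa' orbT.
Qed.

(** If [f] is the minimal polynomial of [q(alpha)], then [f \Po q] vanishes at [alpha], hence at its
    conjugate, so [q(alpha')] is a root of the same monic integral [f]. *)
Lemma Aint_conj (q : {poly rat}) (alpha' : algC) :
  root (map_poly ratr F) alpha' ->
  (map_poly ratr q).[alpha] \in Aint -> (map_poly ratr q).[alpha'] \in Aint.
Proof.
move=> Fa' qA; set x := _.[alpha] in qA.
have [f [Df f_mon] _] := minCpolyP x.
have : root (map_poly ratr (f \Po q)) alpha'.
  apply: root_conj => //.
  by rewrite map_comp_poly /root horner_comp -/x -Df -/(root _ _) root_minCpoly.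
rewrite map_comp_poly /root horner_comp -Df => fx'.
by apply: root_monic_Aint fx' (minCpoly_monic _) qA.
Qed.

End RationalConjugates.

(** Frobenius is additive modulo [p]: induction on the sum for one [p]-th power, then on [a]. *)
Lemma Aint_sum_primeX (p : nat) (I : Type) (s : seq I) (x : I -> algC) a : prime p ->
  (forall i, x i \in Aint) ->
  exists2 z, z \in Aint &
    (\sum_(i <- s) x i) ^+ (p ^ a) = \sum_(i <- s) x i ^+ (p ^ a) + p%:R * z.
Proof.
move=> pr_p xA.
have step (y : I -> algC) : (forall i, y i \in Aint) ->
    exists2 z, z \in Aint & (\sum_(i <- s) y i) ^+ p = \sum_(i <- s) y i ^+ p + p%:R * z.
  move=> yA; elim: s => [|i s' [z zA IH]].
    by exists 0; rewrite ?rpred0 // !big_nil expr0n -leqn0 leqNgt prime_gt0 // mulr0 addr0.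
  have [||w wA Dw] := @exprD_prime_in _ Aint _ pr_p (y i) (\sum_(j <- s') y j).
  - exact: yA.
  - exact: rpred_sum.
  exists (z + y i * (\sum_(j <- s') y j) * w).
    by rewrite rpredD ?rpredM ?rpred_sum.
  by rewrite !big_cons Dw IH; ring.
elim: a => [|a [z zA IH]].
  by exists 0; rewrite ?rpred0 // expn0 mulr0 addr0.
have [i|w wA Dw] := step (fun i => x i ^+ (p ^ a)); first by rewrite rpredX ?xA.
have [||v vA Dv] := @exprD_prime_in _ Aint _ pr_p (\sum_(i <- s) x i ^+ (p ^ a)) (p%:R * z).
- by rewrite rpred_sum // => i _; rewrite rpredX ?xA.
- by rewrite rpredM ?rpred_nat.
set Y := \sum_(i <- s) x i ^+ (p ^ a) in IH Dw Dv.
exists (w + p%:R ^+ p.-1 * z ^+ p + Y * (p%:R * z) * v).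
  have YA : Y \in Aint by rewrite rpred_sum // => i _; rewrite rpredX ?xA.
  by rewrite !rpredD ?rpredM ?rpredX ?rpred_nat.
rewrite expnSr exprM IH Dv Dw.
under [in RHS]eq_bigr do rewrite exprM.
have -> : (p%:R * z) ^+ p = p%:R * p%:R ^+ p.-1 * z ^+ p.
  by rewrite -exprS prednK ?prime_gt0 // exprMn.
ring.
Qed.

(** The quotient [c / p] is a rational algebraic integer, hence an integer. *)
Lemma dvdz_Aint (p : nat) (c : int) (z : algC) :
  (0 < p)%N -> z \in Aint -> c%:~R = p%:R * z -> (p %| c)%Z.
Proof.
move=> p_gt0 zA Dc.
have p0 : (p%:R : algC) != 0 by rewrite pnatr_eq0 -lt0n.
have Dz : z = c%:~R / p%:R by rewrite Dc mulrC mulKf.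
have /intrP[d Dd] : z \is a Num.int.
  by apply: Cint_rat_Aint zA; rewrite Dz rpred_div ?rpred_int ?rpred_nat.
apply/dvdzP; exists d; apply: (@intr_inj algC).
by rewrite Dc Dd rmorphM /= mulrC.
Qed.

(** * Primes of a monogenic order *)

Definition evalZ (x : algC) (e : {poly int}) : algC := (map_poly intr e).[x].

Lemma evalZD x e e' : evalZ x (e + e') = evalZ x e + evalZ x e'.
Proof. by rewrite /evalZ rmorphD hornerD. Qed.

Lemma evalZM x e e' : evalZ x (e * e') = evalZ x e * evalZ x e'.
Proof. by rewrite /evalZ rmorphM hornerM. Qed.

Lemma evalZB x e e' : evalZ x (e - e') = evalZ x e - evalZ x e'.
Proof. by rewrite /evalZ rmorphB hornerD hornerN. Qed.

Lemma evalZX x e n : evalZ x (e ^+ n) = evalZ x e ^+ n.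
Proof. by rewrite /evalZ rmorphXn horner_exp. Qed.

Lemma evalZC x c : evalZ x c%:P = c%:~R.
Proof. by rewrite /evalZ map_polyC hornerC. Qed.

Lemma evalZ_comp x e b : evalZ x (e \Po b) = evalZ (evalZ x b) e.
Proof. by rewrite /evalZ map_comp_poly horner_comp. Qed.

Lemma evalZ_in (S : subringClosed algC) x e : x \in S -> evalZ x e \in S.
Proof.
move=> xS; rewrite /evalZ horner_coef rpred_sum // => i _.
by rewrite coef_map rpredM ?rpredX ?rpred_int.
Qed.

Section Reduction.

Variable p : nat.
Hypothesis pr_p : prime p.

Definition redp (e : {poly int}) : {poly 'F_p} := map_poly intr e.
Definition liftp (f : {poly 'F_p}) : {poly int} := map_poly (fun c : 'F_p => (c : nat)%:Z) f.

HB.instance Definition _ := GRing.RMorphism.copy redp (map_poly (intr : int -> 'F_p)).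

Lemma liftpK : cancel liftp redp.
Proof.
move=> f; apply/polyP => i; rewrite coef_map coef_map_id0 //=.
by rewrite -pmulrn natr_Zp.
Qed.

Lemma redpC c : redp c%:P = (c%:~R)%:P.
Proof. exact: map_polyC. Qed.

Lemma intr_Fp_eq0 (c : int) : ((c%:~R : 'F_p) == 0) = (p %| c)%Z.
Proof.
rewrite dvdzE (dvdn_pcharf (pchar_Fp pr_p)); case: c => c.
  by rewrite -pmulrn.
by rewrite NegzE abszN mulrNz oppr_eq0 -pmulrn.
Qed.

Lemma redp_eq0 e : redp e = 0 -> exists e', e = p%:Z%:P * e'.
Proof.
move=> e0; have eP i : (p %| e`_i)%Z.
  by rewrite -intr_Fp_eq0 -[_%:~R](coef_map intr) /= -/(redp e) e0 coef0.
exists (map_poly (divz^~ p) e); apply/polyP => i.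
by rewrite mul_polyC coefZ coef_map_id0 ?div0z //= mulrC divzK.
Qed.

End Reduction.

(* Primes of [Z[theta]] above [p] are the irreducible factors [g] of [G] modulo [p]. *)
Section Generator.

Variables (S : subringClosed algC) (theta : algC) (G : {poly int}) (p : nat).
Hypothesis pr_p : prime p.
Hypothesis theta_in : theta \in S.
Hypothesis theta_gen : forall x, x \in S -> exists e, x = evalZ theta e.
Hypothesis G_monic : G \is monic.
Hypothesis G_root : evalZ theta G = 0.
Hypothesis G_min : forall e, evalZ theta e = 0 -> exists e', e = e' * G.

Local Notation Gp := (redp p G).

Definition above (g : {poly 'F_p}) (x : algC) : Prop :=
  exists2 e, x = evalZ theta e & g %| redp p e.

Lemma redG_neq0 : Gp != 0.
Proof. by apply: monic_neq0; apply: monic_map. Qed.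

Lemma evalZ_eq0_redp e : evalZ theta e = 0 -> Gp %| redp p e.
Proof. by case/G_min => e' ->; rewrite rmorphM dvdp_mull. Qed.

(** Lifting the quotient modulo [p] writes [e] as a multiple of [G] plus a multiple of [p], and [G]
    vanishes at [theta]. *)
Lemma dvdp_redp_exists e : Gp %| redp p e ->
  exists2 y, y \in S & evalZ theta e = p%:R * y.
Proof.
case/dvdpP => b Db; have : redp p (e - liftp b * G) = 0.
  by rewrite rmorphB rmorphM /= liftpK // Db subrr.
case/(redp_eq0 pr_p) => e' De'; exists (evalZ theta e'); first exact: evalZ_in.
rewrite -[e](subrK (liftp b * G)) De' evalZD !evalZM G_root mulr0 addr0.
by rewrite evalZC -pmulrn.
Qed.

Section Above.

Variable g : {poly 'F_p}.
Hypothesis gG : g %| Gp.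

(** The choice of [e] is immaterial: two representatives of one element differ by a multiple of [G],
    whose reduction [g] divides. *)
Lemma aboveP e : above g (evalZ theta e) <-> g %| redp p e.
Proof.
split=> [[e' De' ge'] | ge]; last by exists e.
have /evalZ_eq0_redp : evalZ theta (e - e') = 0 by rewrite evalZB De' subrr.
move/(dvdp_trans gG); rewrite rmorphB /= dvdp_subl //.
Qed.

Lemma above_horner b (q : {poly int}) :
  above g (evalZ (evalZ theta b) q) <-> g %| redp p q \Po redp p b.
Proof. by rewrite -evalZ_comp aboveP /redp map_comp_poly. Qed.

Hypothesis g_irr : irreducible_poly g.

Lemma above_prime : prime_over S p (above g).
Proof.
split.
- move=> x y [e -> ge] [e' -> ge']; exists (e + e'); rewrite ?evalZD //.
  by rewrite rmorphD dvdp_add.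
- move=> x y /theta_gen[e ->] [e' -> ge']; exists (e * e'); rewrite ?evalZM //.
  by rewrite rmorphM dvdp_mull.
- move=> x y /theta_gen[e ->] /theta_gen[e' ->]; rewrite -evalZM !aboveP rmorphM /=.
  have [|ng] := boolP (g %| redp p e); first by left.
  by rewrite Gauss_dvdpr ?irreducible_poly_coprime //; right.
- rewrite -[1](evalZC theta 1) aboveP rmorph1 dvdp1.
  by apply/negP; rewrite neq_ltn (irredp_gt1 g_irr) orbT.
- rewrite pmulrn -(evalZC theta) aboveP redpC -pmulrn.
  by rewrite (pcharf0 (pchar_Fp pr_p)) dvdp0.
Qed.

(** The residue field of [g] contains a root of [f], so its degree is at least that of [f]. *)
Lemma above_size (f : {poly 'F_p}) x : irreducible_poly f -> x \in S ->
  above g (evalZ x (liftp f)) -> (size f <= size g)%N.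
Proof.
move=> f_irr /theta_gen[b ->]; rewrite above_horner liftpK //.
by apply: leq_size_irreducible_comp => //; apply: irredp_gt1.
Qed.

Lemma above_coprime (f f' : {poly 'F_p}) x : coprimep f f' -> x \in S ->
  above g (evalZ x (liftp f)) -> ~ above g (evalZ x (liftp f')).
Proof.
move=> /Bezout_eq1_coprimepP[[a b] /= ab1] /theta_gen[c ->].
rewrite !above_horner !liftpK // => gf gf'.
have : g %| 1.
  move: ab1 => /(congr1 (comp_poly (redp p c))); rewrite rmorph1 => <-.
  by rewrite comp_polyD !comp_polyM dvdp_add ?dvdp_mull.
by rewrite dvdp1 => /eqP g1; have := irredp_gt1 g_irr; rewrite g1.
Qed.

(** This turns ramification into multiplicity. Let [g^d] be the exact power of [g] in [G] modulo
    [p], with cofactor [k]. Then [t^d k(theta)] is some [p y]. If [d < e], multiplying the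
    hypothesis by [k(theta)] gives [v k(theta) = t^(e-d) h y], which lies in the prime; as [v] does
    not, [g] divides [k], against the choice of [d]. *)
Lemma above_multiplicity h t v e :
  h \in S -> t \in S -> v \in S -> above g t -> ~ above g v ->
  h * t ^+ e = p%:R * v -> g ^+ e %| Gp.
Proof.
move=> hS tS vS gt gv Dhv; have PP := above_prime.
have [|d|d gd d_max] := @ex_maxnP (fun d => g ^+ d %| Gp) (size Gp).
- by exists 0%N; rewrite expr0 dvd1p.
- move/(dvdp_leq redG_neq0)/(leq_trans _); apply; apply: leq_trans (leq_pred _).
  by rewrite size_exp leq_pmull // -subn1 subn_gt0 (irredp_gt1 g_irr).
have [led | ltde] := leqP e d; first by apply: dvdp_trans gd; apply: dvdp_exp2l.
have /dvdpP[k Dk] := gd; have [T DT] := theta_gen tS.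
have gT : g %| redp p T by rewrite -aboveP -DT.
have [|y yS Dy] := @dvdp_redp_exists (T ^+ d * liftp k).
  by rewrite Dk mulrC rmorphM rmorphXn /= liftpK // dvdp_mul // dvdp_exp2r.
have k_in : evalZ theta (liftp k) \in S by apply: evalZ_in.
have p0 : (p%:R : algC) != 0 by rewrite pnatr_eq0 -lt0n prime_gt0.
have Dvk : v * evalZ theta (liftp k) = t ^+ (e - d) * (h * y).
  apply: (mulfI p0); rewrite [LHS]mulrA -Dhv.
  have -> : p%:R * (t ^+ (e - d) * (h * y)) = t ^+ (e - d) * h * (p%:R * y) by ring.
  by rewrite -Dy evalZM evalZX -DT -[in t ^+ e](subnK (ltnW ltde)) exprD; ring.
have : above g (v * evalZ theta (liftp k)).
  rewrite Dvk -(subnSK ltde) exprS -mulrA mulrC.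
  by apply: (prime_overM PP) gt; rewrite !rpredM ?rpredX.
case/(prime_over_prime PP vS k_in) => //.
rewrite aboveP liftpK // => /dvdpP[k' Dk'].
suff /d_max : g ^+ d.+1 %| Gp by rewrite ltnn.
by rewrite Dk Dk' exprS -mulrA dvdp_mull.
Qed.

End Above.

(** An element of all primes above [p] is nilpotent modulo [p]. *)
Lemma above_all_nilpotent x : x \in S ->
  (forall g, g \is monic -> irreducible_poly g -> g %| Gp -> above g x) ->
  exists2 y, y \in S & x ^+ size Gp = p%:R * y.
Proof.
case/theta_gen => e -> gx; rewrite -evalZX; apply: dvdp_redp_exists.
rewrite rmorphXn; apply: dvdp_exp_size redG_neq0 _ => g g_mon g_irr gG.
exact/(aboveP gG)/gx.
Qed.

End Generator.

(** The length [k] of the basis is free in [monogenic], so the degree of [G] has to be bounded.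
    Writing [theta = b(alpha)], linear algebra modulo [F] gives a nonzero rational [q] with
    [size q <= size F] that kills [theta]; after clearing denominators it is a multiple of [G]. *)
Lemma monogenic_generator (alpha : algC) (F : {poly rat}) :
  (1 < size F)%N -> root (map_poly ratr F) alpha -> monogenic alpha ->
  exists theta, exists2 G, [/\ theta \in ZK alpha,
    (forall x, x \in ZK alpha -> exists e, x = evalZ theta e),
    G \is monic, evalZ theta G = 0 &
    (forall e, evalZ theta e = 0 -> exists e', e = e' * G)] &
    (size G <= size F)%N.
Proof.
move=> F_gt1 Fa [theta [k [theta_in gen free]]].
pose of_coefs (c : 'I_k -> int) := \sum_(i < k) c i *: 'X^i : {poly int}.
have ev_of c : evalZ theta (of_coefs c) = \sum_(i < k) (c i)%:~R * theta ^+ i.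
  rewrite /evalZ rmorph_sum horner_sum; apply: eq_bigr => i _.
  by rewrite -mul_polyC rmorphM /= map_polyC map_polyXn hornerM hornerC hornerXn.
(* Expanding [theta^k] in the basis gives the monic relation [G]; freeness of the lower powers then
   kills every remainder modulo [G]. *)
have [c Dc] := gen _ (rpredX k theta_in).
have sz_of c' : (size (of_coefs c') <= k)%N.
  apply: (leq_trans (size_sum _ _ _)); apply/bigmax_leqP => i _.
  by apply: leq_trans (size_scale_leq _ _) _; rewrite size_polyXn.
pose G := 'X^k - of_coefs c.
have szG : size G = k.+1 by rewrite size_polyDl ?size_polyXn // size_polyN ltnS.
have G_mon : G \is monic.
  by rewrite monicE lead_coefDl ?lead_coefXn // size_polyXn size_polyN ltnS.
have G0 : evalZ theta G = 0.
  by rewrite evalZB ev_of -Dc /evalZ map_polyXn hornerXn subrr.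
have G_min e : evalZ theta e = 0 -> exists e', e = e' * G.
  move=> e0; exists (Pdiv.Ring.rdivp e G); rewrite {1}(Pdiv.RingMonic.rdivp_eq G_mon e).
  suff -> : Pdiv.Ring.rmodp e G = 0 by rewrite addr0.
  have szr : (size (Pdiv.Ring.rmodp e G) <= k)%N.
    by rewrite -ltnS -szG Pdiv.Ring.ltn_rmodpN0 // monic_neq0.
  have r0 : evalZ theta (Pdiv.Ring.rmodp e G) = 0.
    have := e0; rewrite {1}(Pdiv.RingMonic.rdivp_eq G_mon e) evalZD evalZM G0.
    by rewrite mulr0 add0r.
  have Dr : Pdiv.Ring.rmodp e G = of_coefs (fun i => (Pdiv.Ring.rmodp e G)`_i).
    rewrite /of_coefs -(poly_def k (fun i => (Pdiv.Ring.rmodp e G)`_i)).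
    apply/polyP => j; rewrite coef_poly; case: ltnP => // lekj.
    by rewrite nth_default // (leq_trans szr).
  rewrite Dr; apply: big1 => i _; rewrite (_ : (Pdiv.Ring.rmodp e G)`_i = 0) ?scale0r //.
  by apply: (free (fun i : 'I_k => (Pdiv.Ring.rmodp e G)`_i)) => //; rewrite -ev_of -Dr.
exists theta, G; first by split=> // x /gen[c' ->]; exists (of_coefs c'); rewrite ev_of.
have /QQadjP[b Db] : theta \in QQadj alpha by case/andP: theta_in.
have [q [q0 szq /dvdpP[q' Dq]]] := dvdp_comp_exists b F_gt1.
have : root (map_poly ratr q) theta.
  rewrite Db /root -horner_comp -map_comp_poly Dq rmorphM /= hornerM.
  by rewrite (rootP Fa) mulr0.
have [Q [a a0 DQ]] := rat_poly_scale q.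
have szQ : size Q = size q.
  rewrite DQ size_scale ?invr_eq0 ?intr_eq0 // size_map_inj_poly ?rmorph0 //.
  exact: intr_inj.
have Q0 : Q != 0 by rewrite -size_poly_gt0 szQ size_poly_gt0.
rewrite DQ map_polyZ rootZ ?fmorph_eq0 ?invr_eq0 ?intr_eq0 // -map_poly_comp => Qth.
have [|Q' DQ'] := G_min Q.
  by apply/eqP; move: Qth; rewrite /root /evalZ; under eq_map_poly do rewrite /= ratr_int.
apply: leq_trans szq; rewrite -szQ DQ'.
have Q'0 : Q' != 0 by apply: contraNneq Q0 => Q'0; rewrite DQ' Q'0 mul0r.
rewrite (size_mul Q'0 (monic_neq0 G_mon)); move: Q'0; rewrite -size_poly_gt0.
by case: (size Q') => // d _; rewrite addSn leq_addl.
Qed.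

(** * The elements [h_k] *)

Section Tower.

Variables (S : subringClosed algC) (t : algC) (M : int) (p r s : nat).
Hypotheses (pr_p : prime p) (p_odd : odd p).
Hypotheses (tS : t \in S) (tM : t ^+ (p ^ r) = M%:~R) (M1 : M != 1).
Hypotheses (le_sr : (s <= r)%N) (pM : (p%:Z ^+ s.+1 %| M - 1)%Z).
Hypothesis S_Aint : {subset S <= Aint}.
Hypothesis Aint_S : forall k x, x \in S -> (p ^ k)%:R^-1 * x \in Aint -> (p ^ k)%:R^-1 * x \in S.

Definition zpow k := t ^+ (p ^ (r - k)).
(* By the geometric sum, [hval k = (M - 1) / (p^k * (zpow k - 1))]. *)
Definition hval k := (p ^ k)%:R^-1 * \sum_(i < p ^ k) zpow k ^+ i.

Local Notation z := zpow.
Local Notation h := hval.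

Lemma zpow_in k : z k \in S.
Proof. exact: rpredX. Qed.

Lemma pX_neq0 k : (p ^ k)%:R != 0 :> algC.
Proof. by rewrite pnatr_eq0 expn_eq0 negb_and -lt0n prime_gt0. Qed.

Lemma zpowS k : (k < r)%N -> z k.+1 ^+ p = z k.
Proof. by move=> ltkr; rewrite /z -exprM -expnSr subnSK. Qed.

Lemma zpowX k : (k <= r)%N -> z k ^+ (p ^ k) = M%:~R.
Proof. by move=> lekr; rewrite /z -exprM -expnD subnK. Qed.

Lemma zpow_neq1 k : (k <= r)%N -> z k - 1 != 0.
Proof.
move=> lekr; rewrite subr_eq0; apply: contraNneq M1 => zk1.
by rewrite -(inj_eq (@intr_inj algC)) -(zpowX lekr) zk1 expr1n.
Qed.

Lemma hval0 : h 0 = 1.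
Proof. by rewrite /h expn0 big_ord1 invr1 mul1r. Qed.

Lemma hval_mul k : (k <= r)%N -> (p ^ k)%:R * (h k * (z k - 1)) = (M - 1)%:~R.
Proof.
move=> lekr; rewrite mulrA mulVKf ?pX_neq0 // mulrC -subrX1 zpowX //.
by rewrite rmorphB.
Qed.

Lemma hval_mul_int k : (k <= s)%N -> exists c : int, h k * (z k - 1) = p%:R * c%:~R /\
  M - 1 = p%:Z ^+ k.+1 * c.
Proof.
move=> leks; have /dvdzP[c Dc] := dvdz_trans (dvdz_exp2l p%:Z (leks : k < s.+1)%N) pM.
exists c; split; last by rewrite Dc mulrC.
apply: (mulfI (pX_neq0 k)); rewrite hval_mul ?(leq_trans leks) // Dc.
by rewrite rmorphM rmorphXn /= -pmulrn mulrA -natrM -expnSr natrX mulrC.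
Qed.

(** Both [p^k h_k (z_k - 1)] and [p^(k+1) h_(k+1) (z_(k+1) - 1)] equal [M - 1]. Expanding
    [z_k = (1 + y)^p] with [y = z_(k+1) - 1] and cancelling [p^k y] gives the relation. *)
Lemma hvalS k : (k < r)%N -> exists2 x, x \in S &
  p%:R * h k.+1 = h k * (p%:R * (1 + (z k.+1 - 1) * x) + (z k.+1 - 1) ^+ p.-1).
Proof.
move=> ltkr; have p_gt0 := prime_gt0 pr_p; set y := z k.+1 - 1.
have yS : y \in S by rewrite rpredB ?zpow_in ?rpred1.
have y0 : y != 0 by apply: zpow_neq1.
have p_gt2 := odd_prime_gt2 p_odd pr_p.
have [x xS Dx] := expr1D_prime_in pr_p p_gt2 yS; exists x => //.
have zy : z k - 1 = y * (p%:R * (1 + y * x) + y ^+ p.-1).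
  rewrite -(zpowS ltkr) (_ : z k.+1 = 1 + y); last by rewrite addrC subrK.
  rewrite Dx -[in y ^+ p](prednK p_gt0) exprS; ring.
apply: (mulIf y0); apply: (mulfI (pX_neq0 k)).
have -> : (p ^ k)%:R * (p%:R * h k.+1 * y) = (M - 1)%:~R.
  by rewrite -(hval_mul ltkr) -/y expnSr natrM; ring.
by rewrite -(hval_mul (ltnW ltkr)) zy; ring.
Qed.

(** The relation of [hvalS] is multiplied by [h_(k+1)^(p-1)]. Since [h_(k+1) (z_(k+1) - 1)] is [p]
    times an integer, its power [p - 1 >= 2] is divisible by [p^2], so a factor [p] survives
    cancellation. *)
Lemma hvalS_root k : (k < s)%N -> exists x c : algC, [/\ x \in S, c \in S &
  h k.+1 ^+ p = h k * ((1 + (z k.+1 - 1) * x) * h k.+1 ^+ p.-1 + p%:R * c)].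
Proof.
move=> ltks; have ltkr := leq_trans ltks le_sr; have p_gt0 := prime_gt0 pr_p.
have [x xS Dx] := hvalS ltkr; have [c [Dc _]] := hval_mul_int ltks.
have p_gt2 := odd_prime_gt2 p_odd pr_p.
have p0 : (p%:R : algC) != 0 by rewrite pnatr_eq0 -lt0n.
exists x, (p%:R ^+ (p - 3) * c%:~R ^+ p.-1); split=> //.
  by rewrite rpredM ?rpredX ?rpred_nat ?rpred_int.
move: Dx Dc; move: (h k) (h k.+1) (z k.+1 - 1) => a b y Dx Dc; apply: (mulfI p0).
have -> : b ^+ p = b * b ^+ p.-1 by rewrite -exprS prednK.
have -> : p%:R * (b * b ^+ p.-1) = a * (p%:R * (1 + y * x) * b ^+ p.-1 + (b * y) ^+ p.-1).
  by rewrite mulrA Dx exprMn; ring.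
have Dp : p%:R ^+ p.-1 = p%:R * p%:R * p%:R ^+ (p - 3) :> algC.
  by rewrite -mulrA -!exprS; congr (_ ^+ _); lia.
by rewrite Dc exprMn Dp; ring.
Qed.

(** By induction, [hvalS_root] exhibits [h_(k+1)] as a root of a monic polynomial
    [X^p - a X^(p-1) - b] with integral [a] and [b]. *)
Lemma hval_in k : (k <= s)%N -> h k \in S.
Proof.
elim: k => [|k IHk] ltks; first by rewrite hval0 rpred1.
have sumS : \sum_(i < p ^ k.+1) z k.+1 ^+ i \in S.
  by rewrite rpred_sum // => i _; rewrite rpredX ?zpow_in.
apply: Aint_S => //; rewrite -/(h k.+1).
have [x [c [xS cS Dh]]] := hvalS_root ltks.
have hS := IHk (ltnW ltks); have p_gt0 := prime_gt0 pr_p.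
pose a := h k * (1 + (z k.+1 - 1) * x); pose b := h k * (p%:R * c).
have aA : a \in Aint.
  by apply: S_Aint; rewrite /a rpredM // rpredD ?rpred1 // rpredM // rpredB ?rpred1 ?zpow_in.
have bA : b \in Aint by apply: S_Aint; rewrite /b rpredM // rpredM ?rpred_nat.
pose q := a *: 'X^(p.-1) + b%:P.
have szq : (size q <= p)%N.
  rewrite (leq_trans (size_polyD _ _)) // geq_max (leq_trans (size_scale_leq _ _)).
    by rewrite (leq_trans (size_polyC_leq1 _)).
  by rewrite size_polyXn prednK.
apply: (@root_monic_Aint_Aint ('X^p - q)).
- by rewrite monicE lead_coefDl ?lead_coefXn // size_polyN size_polyXn ltnS.
- rewrite /root !hornerE Dh /a /b; apply/eqP; ring.
- rewrite rpredB ?rpredD ?polyOverC ?polyOverZ ?rpredX ?polyOverX //.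
Qed.

Section ModPrime.

Variable P : algC -> Prop.
Hypothesis PP : prime_over S p P.

(** Modulo [p], [(t - 1)^(p^r)] is [M - 1] up to a multiple of [p], and [p] divides [M - 1]. *)
Lemma t_sub1_above : P (t - 1).
Proof.
have yS : t - 1 \in S by rewrite rpredB ?rpred1.
have [x xS] := expr1D_primeX_in pr_p r yS.
rewrite [1 + _]addrC subrK tM => Dx.
apply: (prime_overX PP (n := p ^ r)) => //.
have [c [_ Dc]] := hval_mul_int (leq0n s).
have -> : (t - 1) ^+ (p ^ r) = p%:R * (c%:~R - (t - 1) * x).
  apply: (addrI 1); apply: (addIr (p%:R * ((t - 1) * x))); rewrite -Dx.
  by rewrite -[M](subrK 1) Dc expr1 rmorphD rmorphM /= -pmulrn; ring.
by apply: (prime_over_pM PP); rewrite rpredB ?rpredM ?rpred_int.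
Qed.

Lemma zpow_sub1 k : exists2 x, x \in S &
  z k - 1 = (t - 1) ^+ (p ^ (r - k)) + p%:R * ((t - 1) * x).
Proof.
have yS : t - 1 \in S by rewrite rpredB ?rpred1.
have [x xS] := expr1D_primeX_in pr_p (r - k) yS.
rewrite [1 + _]addrC subrK => Dx; exists x => //.
by rewrite /z Dx; ring.
Qed.

Lemma zpow_sub1_above k : P (z k - 1).
Proof.
have [x xS ->] := zpow_sub1 k; have yS : t - 1 \in S by rewrite rpredB ?rpred1.
apply: (prime_overD PP).
  by apply: (prime_over_exp PP) t_sub1_above; rewrite ?expn_gt0 ?prime_gt0.
by apply: (prime_over_pM PP); rewrite rpredM.
Qed.

(* Modulo [P], [h k.+1] is a root of [X^p - h k * X^(p-1)]. *)
Lemma hvalS_above k : (k < s)%N -> P (h k.+1) \/ P (h k.+1 - h k).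
Proof.
move=> ltks; have [x [c [xS cS Dh]]] := hvalS_root ltks.
have hS := hval_in (ltnW ltks); have h'S := hval_in ltks.
have yP := zpow_sub1_above k.+1; have p_gt0 := prime_gt0 pr_p.
have : P (h k.+1 ^+ p.-1 * (h k.+1 - h k)).
  have -> : h k.+1 ^+ p.-1 * (h k.+1 - h k) =
      h k * h k.+1 ^+ p.-1 * x * (z k.+1 - 1) + p%:R * (h k * c).
    by rewrite mulrBr -exprSr prednK // Dh; ring.
  apply: (prime_overD PP); last by apply: (prime_over_pM PP); rewrite rpredM.
  by apply: (prime_overM PP) => //; rewrite rpredM // rpredM // rpredX.
case/(prime_over_prime PP); rewrite ?rpredX ?rpredB //; last by right.
by move=> Phh; left; apply: (prime_overX PP) Phh.
Qed.

Lemma hval_above_mono k : (k < s)%N -> P (h k) -> P (h k.+1).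
Proof.
move=> ltks Phk; have [// | Phh] := hvalS_above ltks.
exact/(prime_over_mod PP Phh).
Qed.

Lemma hval_above_le j k : (j <= k <= s)%N -> P (h j) -> P (h k).
Proof.
case/andP => lejk leks Phj; elim: k lejk leks => [|k IHk].
  by rewrite leqn0 => /eqP <-.
rewrite leq_eqVlt => /predU1P[<- // | ltjk] ltks.
by apply: hval_above_mono => //; apply: IHk => //; apply: ltnW.
Qed.

Lemma hval_above01 k : (k <= s)%N -> P (h k) \/ P (h k - 1).
Proof.
elim: k => [|k IHk] leks.
  by right; rewrite hval0 subrr -(mulr0 p%:R); apply: (prime_over_pM PP); rewrite rpred0.
have [| Phh] := hvalS_above leks; first by left.
have [Ph | Ph] := IHk (ltnW leks); first by left; apply/(prime_over_mod PP Phh).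
by right; rewrite -[h k.+1](subrK (h k)) -addrA; apply: (prime_overD PP).
Qed.

Definition ram_index k := if (k < s)%N then (p.-1 * p ^ (r - k.+1))%N else (p ^ (r - s))%N.

Lemma expDp_in a b n : a \in S -> b \in S -> exists2 x, x \in S &
  (a + p%:R * b) ^+ n = a ^+ n + p%:R * (b * x).
Proof.
move=> aS bS; elim: n => [|n [x xS IH]].
  by exists 0; rewrite ?rpred0 // !expr0 !mulr0 addr0.
exists (a ^+ n + (a + p%:R * b) * x).
  by rewrite rpredD ?rpredM ?rpredD ?rpredM ?rpredX ?rpred_nat.
by rewrite !exprS IH; ring.
Qed.

(** For [k < s], replacing [z_(k+1) - 1] by a power of [t - 1] in [hvalS] gives [v] congruent to
    [h_(k+1) - h_k], hence to [-h_k], modulo [P]. For [k = s], [h_s (z_s - 1) = p c] with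
    [M - 1 = p^(s+1) c], so [v] is congruent to [c]. There an index above 1 forces [s < r], and then
    [p] does not divide [c]. *)
Lemma ramification k : (k <= s)%N -> ((s < r)%N -> ~ (p%:Z ^+ s.+2 %| M - 1)%Z) ->
  ~ P (h k) -> ((k < s)%N -> P (h k.+1)) -> (1 < ram_index k)%N ->
  exists2 v, v \in S & ~ P v /\ h k * (t - 1) ^+ ram_index k = p%:R * v.
Proof.
move=> leks Mp nPh Ph'.
have yS : t - 1 \in S by rewrite rpredB ?rpred1.
have hS := hval_in leks; rewrite /ram_index; case: (ltnP k s) => [ltks _ | lesk ram_gt1].
  have Phk := Ph' ltks; have [x xS Dx] := hvalS (leq_trans ltks le_sr).
  have [x' x'S Dx'] := zpow_sub1 k.+1.
  have [|w wS Dw] := @expDp_in ((t - 1) ^+ (p ^ (r - k.+1))) ((t - 1) * x') p.-1 (rpredX _ yS).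
    by rewrite rpredM.
  pose a := h k * ((z k.+1 - 1) * x + (t - 1) * x' * w).
  have Pa : P a.
    apply: (prime_overM PP) => //; apply: (prime_overD PP); rewrite -?mulrA mulrC;
      apply: (prime_overM PP); rewrite ?rpredM //; [exact: zpow_sub1_above | exact: t_sub1_above].
  exists (h k.+1 - h k - a).
    have aS : a \in S.
      rewrite /a rpredM // rpredD //; last by rewrite rpredM // rpredM.
      by rewrite rpredM // rpredB ?rpred1 ?zpow_in.
    by rewrite rpredB // rpredB // hval_in.
  split=> [Pv|]; first apply: nPh.
    have -> : h k = h k.+1 - a - (h k.+1 - h k - a) by ring.
    by apply: (prime_overB PP) => //; apply: (prime_overB PP).
  have := Dx; rewrite {2}Dx' Dw -exprM mulnC /a => Dh.
  by rewrite !mulrBr Dh; ring.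
have {lesk}Dk : k = s by apply/eqP; rewrite eqn_leq leks.
rewrite {}Dk in hS nPh Ph' *.
have lt_sr : (s < r)%N.
  by rewrite ltnNge; apply: contraL ram_gt1; rewrite -subn_eq0 => /eqP ->.
have [c [Dc Mc]] := hval_mul_int (leqnn s).
have [x xS Dx] := zpow_sub1 s.
exists (c%:~R - h s * (t - 1) * x); first by rewrite rpredB ?rpred_int // rpredM // rpredM.
split=> [Pv|].
  have : P c%:~R.
    rewrite -[c%:~R](subrK (h s * (t - 1) * x)); apply: (prime_overD PP) Pv _.
    by rewrite mulrAC; apply: (prime_overM PP) t_sub1_above; rewrite rpredM.
  move/(prime_over_int PP pr_p) => /dvdzP[d Dd]; apply: (Mp lt_sr).
  by rewrite Mc Dd mulrCA -exprSr dvdz_mull.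
by rewrite mulrBr -Dc Dx; ring.
Qed.

End ModPrime.

End Tower.

(** * Existence of primes by traces *)

(* Conjugating [q(alpha)^(p^a) = p * y] and summing, the [p^a]-th power of the partial trace is
   divisible by [p] in the algebraic integers. *)
Lemma dvdz_sum_conj (F : {poly rat}) (alpha : algC) (p a N : nat) (q : {poly rat})
    (conj : 'I_N -> algC) (y : algC) (c : int) :
  irreducible_poly F -> root (map_poly ratr F) alpha ->
  (forall l, root (map_poly ratr F) (conj l)) -> prime p ->
  (map_poly ratr q).[alpha] \in Aint -> y \in ZK alpha ->
  (map_poly ratr q).[alpha] ^+ (p ^ a) = p%:R * y ->
  \sum_l (map_poly ratr q).[conj l] = c%:~R -> (p %| c)%Z.
Proof.
move=> F_irr Fa Fconj pr_p qA /andP[/QQadjP[Y ->] YA] DqY Dc.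
have evalE x : (map_poly ratr (q ^+ (p ^ a) - p%:R%:P * Y)).[x] =
    (map_poly ratr q).[x] ^+ (p ^ a) - p%:R * (map_poly ratr Y).[x] :> algC.
  by rewrite rmorphB rmorphXn rmorphM /= map_polyC !hornerE /= ratr_nat.
have Dconj l : (map_poly ratr q).[conj l] ^+ (p ^ a) = p%:R * (map_poly ratr Y).[conj l].
  apply/eqP; rewrite -subr_eq0 -evalE -/(root _ _); apply: (root_conj F_irr Fa) => //.
  by rewrite /root evalE DqY subrr.
have [l|z zA] := @Aint_sum_primeX p _ (index_enum 'I_N) (fun l => (map_poly ratr q).[conj l]) a pr_p.
  exact: (Aint_conj F_irr Fa).
rewrite Dc (eq_bigr _ (fun l _ => Dconj l)) -mulr_sumr -mulrDr -rmorphXn /= => Dcz.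
have : (p %| c ^+ (p ^ a))%Z.
  apply: dvdz_Aint (prime_gt0 pr_p) _ Dcz; rewrite rpredD // rpred_sum // => l _.
  exact: (Aint_conj F_irr Fa).
by rewrite !dvdzE abszX Euclid_dvdX // => /andP[].
Qed.

Lemma sum_prim_rootX (N i : nat) (w : algC) : N.-primitive_root w ->
  \sum_(l < N) (w ^+ i) ^+ l = if (N %| i)%N then N%:R else 0.
Proof.
move=> w_prim; rewrite (prim_order_dvd w_prim); have [-> | wi1] := eqVneq.
  by under eq_bigr do rewrite expr1n; rewrite sumr_const card_ord.
have w0 : w ^+ i - 1 != 0 by rewrite subr_eq0.
by apply: (mulfI w0); rewrite -subrX1 exprAC (prim_expr_order w_prim) expr1n subrr mulr0.
Qed.

(** Modulo [p^a] only the second term remains; as [u (p - 1)] is prime to [p], [p^k] divides [i], so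
    [i = 0]. Then [u] divides [c], so [c = 0]. *)
Lemma dvdn_trace_exponent u p a k c i : prime p -> (0 < u)%N -> ~~ (p %| u)%N -> (k <= a)%N ->
  (c < u)%N -> (i < p ^ k)%N ->
  (u * p ^ a %| p ^ a * c + u * p.-1 * p ^ (a - k) * i)%N = (c == 0)%N && (i == 0)%N.
Proof.
move=> pr_p u_gt0 p_u leka ltcu ltik.
have pX_gt0 j : (0 < p ^ j)%N by rewrite expn_gt0 prime_gt0.
apply/idP/andP => [dv | [/eqP-> /eqP->]]; last by rewrite !muln0 dvdn0.
have : (p ^ k %| i)%N.
  have : (p ^ a %| u * p.-1 * p ^ (a - k) * i)%N.
    have := dvdn_trans (dvdn_mull u (dvdnn _)) dv.
    by rewrite dvdn_addr // dvdn_mulr.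
  rewrite -[in (p ^ a)%N](subnK leka) expnD -!mulnA [(p.-1 * _)%N]mulnCA !mulnA.
  rewrite [(u * _)%N]mulnC -!mulnA dvdn_pmul2l // mulnA Gauss_dvdr //.
  rewrite coprimeXl // prime_coprime // Euclid_dvdM // negb_or p_u /=.
  by have p_gt1 := prime_gt1 pr_p; rewrite gtnNdvd //; move: p_gt1; case: (p) => [|[|?]].
have [i0 _ | i_gt0 /(dvdn_leq i_gt0)] := posnP i; last by rewrite leqNgt ltik.
move: dv; rewrite i0 muln0 addn0 mulnC dvdn_pmul2l // => u_c; split=> //.
by have [// | c_gt0] := posnP c; have := dvdn_leq c_gt0 u_c; rewrite leqNgt ltcu.
Qed.

Section Trace.

Variables (n u r p k a : nat) (alpha zeta : algC).
Hypotheses (pr_p : prime p) (u_gt0 : (0 < u)%N) (p_u : ~~ (p %| u)%N).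
Hypotheses (Dn : n = (u * p ^ r)%N) (zeta_prim : n.-primitive_root zeta).
Hypotheses (leka : (k <= a)%N) (lear : (a <= r)%N).

(** All exponents of [alpha] in the expanded product are multiples of [p^(r-a)], so [u p^a]
    conjugates suffice for the roots of unity to cancel every term but the constant one. A full
    trace would bring in the unwanted factor [p^(r-a)]. *)
Lemma sum_conj_kappa (kappa : {poly int}) : (size kappa <= u)%N ->
  \sum_(l < u * p ^ a) evalZ ((alpha * zeta ^+ l) ^+ (p ^ r)) kappa
     * hval ((alpha * zeta ^+ l) ^+ (u * p.-1)) p r k = (u * p ^ (a - k))%:R * (kappa`_0)%:~R.
Proof.
move=> szk; set N := (u * p ^ a)%N.
have pX_gt0 j : (0 < p ^ j)%N by rewrite expn_gt0 prime_gt0.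
have D_gt0 : (0 < p ^ (r - a))%N by [].
have DnN : n = (N * p ^ (r - a))%N by rewrite Dn -mulnA -expnD subnKC.
have w_prim : N.-primitive_root (zeta ^+ (p ^ (r - a))).
  have := @dvdn_prim_root _ _ _ zeta_prim N.
  have N_gt0 : (0 < N)%N by rewrite muln_gt0 u_gt0 pX_gt0.
  by rewrite DnN mulKn // => -> //; rewrite dvdn_mulr.
pose J c i := (p ^ a * c + u * p.-1 * p ^ (a - k) * i)%N.
have expand l : evalZ ((alpha * zeta ^+ l) ^+ (p ^ r)) kappa
     * hval ((alpha * zeta ^+ l) ^+ (u * p.-1)) p r k =
   \sum_(c < u) \sum_(i < p ^ k) (p ^ k)%:R^-1 * (kappa`_c)%:~R *
      (alpha ^+ (p ^ (r - a) * J c i) * (zeta ^+ (p ^ (r - a)) ^+ J c i) ^+ l).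
  rewrite /evalZ (@horner_coef_wide _ u) ?(leq_trans (size_poly _ _)) //.
  rewrite mulr_suml; apply: eq_bigr => c _; rewrite /hval mulrCA mulr_sumr mulr_sumr.
  apply: eq_bigr => i _; rewrite coef_map /= -!mulrA; congr (_ * (_ * _)).
  rewrite /zpow -[zeta ^+ _ ^+ J c i]exprM [_ ^+ (_ * J c i) ^+ l]exprAC -exprMn.
  rewrite -!exprM -exprD; congr (_ ^+ _).
  rewrite /J.
  rewrite mulnDr !mulnA -expnD subnK //; congr (_ + _)%N.
  rewrite -[(r - k)%N](subnK (leq_sub2l r leka)).
  have -> : (r - k - (r - a) = a - k)%N by lia.
  rewrite expnD; lia.
under eq_bigr do rewrite expand.
rewrite exchange_big /=; under eq_bigr do rewrite exchange_big /=.
have inner (c : 'I_u) (i : 'I_(p ^ k)) :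
    \sum_(l < N) (p ^ k)%:R^-1 * (kappa`_c)%:~R *
      (alpha ^+ (p ^ (r - a) * J c i) * (zeta ^+ (p ^ (r - a)) ^+ J c i) ^+ l) =
    if (c == 0 :> nat) && (i == 0 :> nat) then (u * p ^ (a - k))%:R * (kappa`_0)%:~R else 0.
  rewrite -!mulr_sumr (sum_prim_rootX _ w_prim) /J /N dvdn_trace_exponent //.
  case: ifP => [/andP[/eqP-> /eqP->] | _]; last by rewrite !mulr0.
  rewrite !muln0 expr0 mul1r mulrAC; congr (_ * _).
  by rewrite -[in (p ^ a)%N](subnK leka) expnD mulnA natrM mulrC mulfK // pX_neq0.
rewrite (eq_bigr _ (fun c _ => eq_bigr _ (fun i _ => inner c i))).
rewrite (bigD1 (Ordinal u_gt0)) //= (bigD1 (Ordinal (pX_gt0 k))) //=.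
rewrite big1 => [|i i0]; last by rewrite ifN.
rewrite big1 ?addr0 // => c c0; apply: big1 => i _.
by rewrite ifN // negb_and; apply/orP; left.
Qed.

End Trace.

(** * The primes attached to a factor [f] and an index [k] *)

Section Classes.

Variables (n u r s p : nat) (m : int) (alpha theta : algC) (G : {poly int}).

Local Notation S := (ZK alpha).
Local Notation M := (m ^+ p.-1).
Local Notation t := (alpha ^+ (u * p.-1)).
Local Notation beta := (alpha ^+ (p ^ r)).
Local Notation h := (hval t p r).
Local Notation above := (@above theta p).
Local Notation F := ('X^n - (m%:~R)%:P : {poly rat}).
Local Notation Xum := ('X^u - (m%:~R)%:P : {poly 'F_p}).

Hypotheses (pr_p : prime p) (p_odd : odd p) (u_gt0 : (0 < u)%N).
Hypotheses (p_u : ~~ (p %| u)%N) (p_m : ~~ (p %| m)%Z).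
Hypotheses (Dn : n = (u * p ^ r)%N) (Dm : alpha ^+ n = m%:~R).
Hypothesis F_irr : irreducible_poly F.
Hypotheses (M1 : M != 1) (le_sr : (s <= r)%N) (pM : (p%:Z ^+ s.+1 %| M - 1)%Z).
Hypothesis theta_in : theta \in S.
Hypothesis theta_gen : forall x, x \in S -> exists e, x = evalZ theta e.
Hypotheses (G_monic : G \is monic) (G_root : evalZ theta G = 0).
Hypothesis G_min : forall e, evalZ theta e = 0 -> exists e', e = e' * G.

Lemma alpha_ZK : alpha \in S.
Proof.
apply/andP; split; first by apply/QQadjP; exists 'X; rewrite map_polyX hornerX.
have n_gt0 : (0 < n)%N by rewrite Dn muln_gt0 u_gt0 expn_gt0 prime_gt0.
apply: (@root_monic_Aint ('X^n - (m%:~R)%:P)); first by rewrite rootE !hornerE Dm subrr.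
  exact: monicXnsubC.
apply/polyOverP => i; rewrite coefB coefXn coefC rpredB ?rpred_nat //.
by case: ifP => _; rewrite ?rpred_int ?rpred0.
Qed.

Lemma t_ZK : t \in S.
Proof. by rewrite rpredX ?alpha_ZK. Qed.

Lemma beta_ZK : beta \in S.
Proof. by rewrite rpredX ?alpha_ZK. Qed.

Lemma t_expX : t ^+ (p ^ r) = M%:~R.
Proof. by rewrite -exprM mulnAC -Dn exprM Dm -rmorphXn. Qed.

Lemma beta_expX : beta ^+ u = m%:~R.
Proof. by rewrite -exprM mulnC -Dn. Qed.

Lemma sub_ZK_Aint : {subset S <= Aint}.
Proof. by move=> x /andP[]. Qed.

Lemma ZK_divX k x : x \in S -> (p ^ k)%:R^-1 * x \in Aint -> (p ^ k)%:R^-1 * x \in S.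
Proof.
move=> /andP[/QQadjP[q ->] _] xA; rewrite unfold_in xA andbT.
apply/QQadjP; exists (((p ^ k)%:R^-1)%:P * q).
by rewrite rmorphM /= map_polyC hornerM hornerC /= fmorphV /= ratr_nat.
Qed.

Lemma hval_ZK k : (k <= s)%N -> h k \in S.
Proof. exact: (hval_in pr_p p_odd t_ZK t_expX M1 le_sr pM sub_ZK_Aint ZK_divX). Qed.

(** As [h k] is 0 or 1 modulo a prime, [~ above g (h k)] says that it is 1: [k] is the last index
    where this happens. *)
Definition prime_class g (f : {poly 'F_p}) k :=
  [/\ above g (evalZ beta (liftp f)), ~ above g (h k) & (k < s)%N -> above g (h k.+1)].

(** This and [rational_hval] express the elements as rational polynomials in [alpha], uniformly in
    [alpha], so that they can be conjugated. *)
Lemma rational_kappa (kappa : {poly int}) :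
  exists Q : {poly rat}, forall z : algC, (map_poly ratr Q).[z] = evalZ (z ^+ (p ^ r)) kappa.
Proof.
exists (map_poly intr kappa \Po 'X^(p ^ r)) => z.
rewrite map_comp_poly horner_comp map_polyXn hornerXn -map_poly_comp /evalZ.
by congr (_.[_]); apply: eq_map_poly => b; rewrite /= ratr_int.
Qed.

Lemma rational_hval : exists Q : nat -> {poly rat}, forall k (z : algC),
  (map_poly ratr (Q k)).[z] = hval (z ^+ (u * p.-1)) p r k.
Proof.
exists (fun k => ((p ^ k)%:R^-1)%:P * \sum_(i < p ^ k) 'X^(u * p.-1 * p ^ (r - k) * i)) => k z.
rewrite rmorphM /= map_polyC hornerM hornerC /= fmorphV /= ratr_nat /hval; congr (_ * _).
rewrite rmorph_sum horner_sum; apply: eq_bigr => i _.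
by rewrite /= map_polyXn hornerXn /zpow -!exprM !mulnA.
Qed.

(** Let [kappa] lift the cofactor of [f] in [X^u - m]. If no prime were in the class,
    [x = kappa(beta) (h_k - h_(k+1))], or [kappa(beta) h_s] for [k = s], would lie in every prime
    above [p] and so be nilpotent modulo [p]. Its partial trace would be divisible by [p], but that
    trace is [u (p - 1) kappa(0)], or [u kappa(0)] for [k = s]. *)
Lemma class_exists f k : irreducible_poly f -> f %| Xum -> (k <= s)%N ->
  exists g, [/\ g \is monic, irreducible_poly g, g %| redp p G & prime_class g f k].
Proof.
move=> f_irr /dvdpP[c Dc] leks; apply: contrapT => no_g.
pose kappa := liftp c; pose d := if (k < s)%N then h k.+1 else 0.
have dS : d \in S by rewrite /d; case: ifP => [/hval_ZK // | _]; apply: rpred0.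
have hS := hval_ZK leks.
have kS : evalZ beta kappa \in S by apply: evalZ_in beta_ZK.
pose x := evalZ beta kappa * (h k - d).
have xS : x \in S by rewrite rpredM // rpredB.
have x_above g : g \is monic -> irreducible_poly g -> g %| redp p G -> above g x.
  move=> g_mon g_irr gG.
  have PP := above_prime pr_p theta_gen G_min gG g_irr.
  have [// | ngx] := pselect (above g x); case: no_g; exists g; split=> //.
  have mono := hval_above_mono pr_p p_odd t_ZK t_expX M1 le_sr pM sub_ZK_Aint ZK_divX PP.
  have h01 := hval_above01 pr_p p_odd t_ZK t_expX M1 le_sr pM sub_ZK_Aint ZK_divX PP.
  have ngk : ~ above g (evalZ beta kappa).
    by move=> gk; apply: ngx; rewrite /x mulrC; apply: (prime_overM PP); rewrite ?rpredB.
  have ngh : ~ above g (h k - d) by move=> gh; apply: ngx; apply: (prime_overM PP).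
  split.
  (* Modulo [p] the product of [kappa] and the lift of [f] is [X^u - m], which vanishes at
     [beta]. *)
  - have : above g (evalZ beta (kappa * liftp f)).
      have [b Db] := theta_gen beta_ZK.
      rewrite Db (above_horner G_min gG) (rmorphM (redp p)) /= !liftpK //.
      have : above g (evalZ beta ('X^u - m%:P)).
        rewrite /evalZ rmorphB /= map_polyXn map_polyC !hornerE beta_expX subrr.
        by rewrite -(mulr0 p%:R); apply: (prime_over_pM PP); rewrite rpred0.
      rewrite Db (above_horner G_min gG) -Dc (rmorphB (redp p)) /= redpC; congr (g %| (_ - _) \Po _).
      by rewrite /redp map_polyXn.
    rewrite evalZM => /(prime_over_prime PP kS); case=> //.
    exact: evalZ_in beta_ZK.
  - move=> ghk; apply: ngh; apply: (prime_overB PP) => //; rewrite /d.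
    case: ifP => [lt_ks | _]; first exact: mono.
    by rewrite -(mulr0 p%:R); apply: (prime_over_pM PP); rewrite rpred0.
  - move=> ltks; have [// | gh1] := h01 k.+1 ltks.
    have [ghk | ghk] := h01 k leks; first exact: mono.
    case: ngh; rewrite /d ltks; have -> : h k - h k.+1 = (h k - 1) - (h k.+1 - 1) by ring.
    exact: (prime_overB PP).
have [y yS Dy] := above_all_nilpotent pr_p theta_in theta_gen G_monic G_root G_min xS x_above.
have [Qk Qk_eval] := rational_kappa kappa; have [Qh Qh_eval] := rational_hval.
pose Q := Qk * (Qh k - if (k < s)%N then Qh k.+1 else 0).
have Q_eval z : (map_poly ratr Q).[z] = evalZ (z ^+ (p ^ r)) kappa *
    (hval (z ^+ (u * p.-1)) p r k
     - if (k < s)%N then hval (z ^+ (u * p.-1)) p r k.+1 else 0) :> algC.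
  rewrite rmorphM rmorphB /= hornerM Qk_eval hornerD hornerN Qh_eval.
  by case: ifP => _; rewrite ?Qh_eval // rmorph0 horner0.
have n_gt0 : (0 < n)%N by rewrite Dn muln_gt0 u_gt0 expn_gt0 prime_gt0.
have [zeta zeta_prim] := C_prim_root_exists n_gt0.
have F_conj l : root (map_poly ratr F) (alpha * zeta ^+ l).
  rewrite rmorphB /= map_polyXn map_polyC /= ratr_int rootE !hornerE.
  by rewrite exprMn Dm exprAC (prim_expr_order zeta_prim) expr1n mulr1 subrr.
have f_gt1 : (1 < size f)%N := irredp_gt1 f_irr.
have sz_c : (size c <= u)%N.
  have [-> | c0] := eqVneq c 0; first by rewrite size_poly0.
  have : u.+1 = (size c + size f).-1.
    rewrite -(size_XnsubC (m%:~R : 'F_p) u_gt0) Dc size_mul //.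
    by rewrite -size_poly_gt0 ltnW.
  by move: f_gt1; case: (size f) => [|[|j]] // _; rewrite !addnS => -[->]; apply: leq_addr.
have sz_kappa : (size kappa <= u)%N by apply: leq_trans (size_poly _ _) sz_c.
(* The constant terms of [c] and [f] multiply to [-m], which is nonzero modulo [p]. *)
have p_kappa0 : ~~ (p %| kappa`_0)%Z.
  have -> : (p %| kappa`_0)%Z = (c`_0 == 0).
    by rewrite -(intr_Fp_eq0 pr_p) -[in RHS](liftpK c) coef_map.
  apply: contra p_m => c0; rewrite -(intr_Fp_eq0 pr_p).
  have /eqP := congr1 (fun q : {poly 'F_p} => q`_0) Dc.
  by rewrite coef0M (eqP c0) mul0r coefB coefXn coefC eqxx (ltn_eqF u_gt0) sub0r oppr_eq0.
(* The nilpotency exponent is raised to a power of [p], as Frobenius requires. *)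
have Dy' : (map_poly ratr Q).[alpha] ^+ (p ^ size (redp p G))
    = p%:R * (y * x ^+ (p ^ size (redp p G) - size (redp p G))).
  rewrite Q_eval (_ : _ * _ = x); last by rewrite /x /d; case: ifP.
  rewrite mulrA -Dy -exprD subnKC // ltnW // ltn_expl //; exact: prime_gt1.
have y'S : y * x ^+ (p ^ size (redp p G) - size (redp p G)) \in S by rewrite rpredM ?rpredX.
have QA : (map_poly ratr Q).[alpha] \in Aint.
  rewrite Q_eval (_ : _ * _ = x); last by rewrite /x /d; case: ifP.
  exact: sub_ZK_Aint.
have F_alpha : root (map_poly ratr F) alpha by have := F_conj 0; rewrite expr0 mulr1.
have absurd N (c' : int) : \sum_(l < N) (map_poly ratr Q).[alpha * zeta ^+ l] = c'%:~R -> (p %| c')%Z.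
  by apply: dvdz_sum_conj F_irr F_alpha _ pr_p QA y'S Dy' => l; apply: F_conj.
have sumE := sum_conj_kappa alpha pr_p u_gt0 p_u Dn zeta_prim.
have p_kappaM (b : nat) : (p %| b%:Z * kappa`_0)%Z -> (p %| b)%N.
  by move: p_kappa0; rewrite !dvdzE abszM Euclid_dvdM // => /negPf->; rewrite orbF.
case: (ltnP k s) => [lt_ks | le_sk].
  (* With [a = k + 1] the traces with [h_k] and [h_(k+1)] are [u p kappa(0)] and [u kappa(0)]. *)
  have := absurd (u * p ^ k.+1)%N ((u * p.-1)%:Z * kappa`_0).
  rewrite (eq_bigr _ (fun l _ => Q_eval _)) lt_ks.
  under eq_bigr do rewrite mulrBr.
  have lekr := leq_trans lt_ks le_sr.
  rewrite sumrB !sumE // subnn subSnn expn0 muln1 expn1 -mulrBl -natrB ?leq_pmulr ?prime_gt0 //.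
  rewrite (_ : u * p - u = u * p.-1)%N; last by rewrite -subn1 mulnBr muln1.
  rewrite intrM => /(_ erefl).
  move/p_kappaM; rewrite Euclid_dvdM // (negPf p_u) /=.
  by have p_gt1 := prime_gt1 pr_p; rewrite gtnNdvd //; move: p_gt1; case: (p) => [|[|?]].
have Dk : k = s by apply/eqP; rewrite eqn_leq leks.
have := absurd (u * p ^ s)%N (u%:Z * kappa`_0).
rewrite (eq_bigr _ (fun l _ => Q_eval _)) Dk ltnn.
under eq_bigr do rewrite subr0.
rewrite sumE // subnn expn0 muln1 intrM => /(_ erefl).
by move/p_kappaM; apply/negP.
Qed.

Hypothesis pM_max : (s < r)%N -> ~ (p%:Z ^+ s.+2 %| M - 1)%Z.

Section PrimeClass.

Variables (g f : {poly 'F_p}) (k : nat).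
Hypotheses (g_irr : irreducible_poly g) (gG : g %| redp p G) (leks : (k <= s)%N).
Hypothesis gfk : prime_class g f k.

Lemma class_multiplicity : g ^+ ram_index p r s k %| redp p G.
Proof.
(* For index at most 1, [gG] suffices; this covers [k = s = r], where [p^(s+2)] may divide
   [M - 1]. *)
have [ram_le1 | ram_gt1] := leqP (ram_index p r s k) 1.
  by apply: dvdp_trans gG; rewrite -[X in _ %| X]expr1 dvdp_exp2l.
have PP := above_prime pr_p theta_gen G_min gG g_irr; case: gfk => _ nPh Ph'.
have [v vS [nPv Dv]] := ramification pr_p p_odd t_ZK t_expX M1 le_sr pM sub_ZK_Aint ZK_divX PP
  leks pM_max nPh Ph' ram_gt1.
apply: (above_multiplicity pr_p theta_in theta_gen G_monic G_root G_min gG g_irr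
  (hval_ZK leks) _ vS _ nPv Dv); first by rewrite rpredB ?t_ZK ?rpred1.
exact: (t_sub1_above pr_p t_ZK t_expX le_sr pM PP).
Qed.

Lemma class_size : irreducible_poly f -> (size f <= size g)%N.
Proof.
move=> f_irr; case: gfk => gf _ _.
exact: (above_size theta_gen G_min gG g_irr f_irr beta_ZK gf).
Qed.

End PrimeClass.

(** Distinct monic irreducible [f] and [f'] are coprime and cannot both vanish at [beta]. Once [h_j]
    vanishes modulo the prime, so do all later ones, which fixes [k]. *)
Lemma class_unique g f f' k k' : irreducible_poly g -> g %| redp p G ->
  f \is monic -> irreducible_poly f -> f' \is monic -> irreducible_poly f' ->
  (k <= s)%N -> (k' <= s)%N -> prime_class g f k -> prime_class g f' k' ->
  f = f' /\ k = k'.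
Proof.
move=> g_irr gG f_mon f_irr f'_mon f'_irr leks lek's [gf nPk Pk] [gf' nPk' Pk'].
have PP := above_prime pr_p theta_gen G_min gG g_irr.
have mono := hval_above_le pr_p p_odd t_ZK t_expX M1 le_sr pM sub_ZK_Aint ZK_divX PP.
split.
  apply: monic_irreducible_dvdp_eq => //; apply/negPn.
  rewrite -irreducible_poly_coprime //; apply/negP => cop.
  exact: (above_coprime theta_gen G_min gG g_irr cop beta_ZK gf gf').
have [ltkk' | ltk'k | //] := ltngtP k k'.
  by case: nPk'; apply: (mono k.+1 k'); [rewrite ltkk' | apply/Pk/(leq_trans ltkk')].
by case: nPk; apply: (mono k'.+1 k); [rewrite ltk'k | apply/Pk'/(leq_trans ltk'k)].
Qed.

End Classes.

(** * Counting *)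

(** The sum telescopes, since [(p - 1) p^(r-k-1) = p^(r-k) - p^(r-k-1)]. *)
Lemma sum_ram_index p r s : (0 < p)%N -> (s <= r)%N ->
  (\sum_(k <- iota 0 s.+1) ram_index p r s k)%N = (p ^ r)%N.
Proof.
move=> p_gt0 lesr; rewrite -/(index_iota 0 s.+1) big_nat_recr //= {2}/ram_index ltnn.
rewrite (eq_big_nat _ _ (F2 := fun k => p.-1 * p ^ (r - k.+1))%N) => [|k /= ltks]; last first.
  by rewrite /ram_index ltks.
elim: s lesr => [|s IHs] lesr; first by rewrite big_geq // subn0.
rewrite big_nat_recr //= -(IHs (ltnW lesr)) -addnA; congr (_ + _)%N.
by rewrite -(subnSK lesr) expnS -{2}[(p ^ _)%N]mul1n -mulnDl addn1 prednK.
Qed.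

Lemma size_prod_monicX (R : idomainType) (I : Type) (s : seq I) (g : I -> {poly R}) (e : I -> nat) :
  (forall i, g i \is monic) ->
  (size (\prod_(i <- s) g i ^+ e i)).-1 = (\sum_(i <- s) e i * (size (g i)).-1)%N.
Proof.
move=> g_mon; elim: s => [|i s IHs]; first by rewrite !big_nil size_poly1.
rewrite !big_cons size_monicM ?rpredX //; last first.
  by rewrite monic_neq0 // rpred_prod // => j _; rewrite rpredX.
have := size_exp (g i) (e i); rewrite mulnC => <-; rewrite -IHs.
have : (0 < size (g i ^+ e i)%R)%N by rewrite size_poly_gt0 monic_neq0 ?rpredX.
have : (0 < size (\prod_(j <- s) g j ^+ e j)%R)%N.
  by rewrite size_poly_gt0 monic_neq0 // rpred_prod // => j _; rewrite rpredX.
by case: (size _) => // a _; case: (size _) => // b _; rewrite addSn addnS.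
Qed.

Lemma leq_sum_seq_eq (I : eqType) (s : seq I) (a b : I -> nat) :
  {in s, forall i, a i <= b i}%N -> (\sum_(i <- s) b i <= \sum_(i <- s) a i)%N ->
  {in s, forall i, a i = b i}.
Proof.
move=> ab sba i si; apply/eqP; rewrite eqn_leq ab //= leqNgt; apply/negP => ltab.
move: sba; rewrite (big_rem i) //= [X in (_ <= X)%N](big_rem i) //= leqNgt => /negP; apply.
rewrite -addSn leq_add // big_seq [X in (_ <= X)%N]big_seq; apply: leq_sum => j sj.
by apply/ab/(mem_rem sj).
Qed.

Lemma irreducible_dvdp_prod (F : fieldType) (f : {poly F}) (s : seq {poly F}) :
  f \is monic -> irreducible_poly f ->
  {in s, forall g, g \is monic /\ irreducible_poly g} ->
  f %| \prod_(g <- s) g -> f \in s.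
Proof.
move=> f_mon f_irr; elim: s => [|g s IHs] sP.
  by rewrite big_nil dvdp1 => /eqP f1; have := irredp_gt1 f_irr; rewrite f1.
have [g_mon g_irr] := sP g (mem_head _ _).
rewrite big_cons inE; have [fg _ | nfg] := boolP (f %| g).
  by rewrite (monic_irreducible_dvdp_eq f_mon f_irr g_mon g_irr fg) eqxx.
rewrite Gauss_dvdpr ?irreducible_poly_coprime // => fs; apply/orP; right.
by apply: IHs fs => h hs; apply: sP; rewrite inE hs orbT.
Qed.

(** * Monic polynomials of degree [d] as coefficient vectors *)

Section MonicOf.

Variables (p d : nat).

Lemma coef_sum_monic_of (c : {ffun 'I_d -> 'F_p}) :
  \sum_(i < d) (c i)%:P * 'X^i = \poly_(i < d) (if insub i is Some j then c j else 0).
Proof. by rewrite poly_def; apply: eq_bigr => i _; rewrite valK mul_polyC. Qed.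

Lemma size_monic_of (c : {ffun 'I_d -> 'F_p}) : size (monic_of c) = d.+1.
Proof. by rewrite /monic_of coef_sum_monic_of size_polyDl ?size_polyXn // ltnS size_poly. Qed.

Lemma monic_of_monic (c : {ffun 'I_d -> 'F_p}) : monic_of c \is monic.
Proof.
rewrite monicE /monic_of coef_sum_monic_of lead_coefDl ?lead_coefXn //.
by rewrite size_polyXn ltnS size_poly.
Qed.

Lemma coef_monic_of (c : {ffun 'I_d -> 'F_p}) (i : 'I_d) : (monic_of c)`_i = c i.
Proof.
by rewrite /monic_of coef_sum_monic_of coefD coefXn coef_poly ltn_ord (ltn_eqF (ltn_ord i)) add0r valK.
Qed.

Lemma monic_of_inj : injective (@monic_of p d).
Proof. by move=> c c' cc'; apply/ffunP => i; rewrite -!coef_monic_of cc'. Qed.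

Lemma monic_ofE (q : {poly 'F_p}) : q \is monic -> size q = d.+1 ->
  monic_of [ffun i : 'I_d => q`_i] = q.
Proof.
move=> q_mon szq; apply/polyP => i; have [ltid | ltdi | ->] := ltngtP i d.
- by rewrite -[i]/(val (Ordinal ltid)) coef_monic_of ffunE.
- by rewrite !nth_default ?size_monic_of ?szq.
have lc (q' : {poly 'F_p}) : q' \is monic -> size q' = d.+1 -> q'`_d = 1.
  by move=> /monicP; rewrite lead_coefE => + szq'; rewrite szq'.
by rewrite !lc ?size_monic_of ?monic_of_monic.
Qed.

End MonicOf.

(* Since [sum_k ram_index k = p^r] and the factors [f] of [X^u - m] have total degree [u], the [g]
   already account for the whole degree of [G], so no [g] has degree larger than its [f]. *)
Lemma class_size_eq (p u r s : nat) (Q Gp : {poly 'F_p}) (fs : seq {poly 'F_p})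
    (g : {poly 'F_p} * nat -> {poly 'F_p}) :
  prime p -> (s <= r)%N -> uniq fs ->
  {in fs, forall f, f \is monic /\ irreducible_poly f} -> Q = \prod_(f <- fs) f ->
  size Q = u.+1 -> Gp != 0 -> (size Gp <= (u * p ^ r).+1)%N ->
  (forall f k, f \in fs -> (k <= s)%N -> [/\ g (f, k) \is monic, irreducible_poly (g (f, k)),
     (size f <= size (g (f, k)))%N & g (f, k) ^+ ram_index p r s k %| Gp]) ->
  (forall f k f' k', f \in fs -> f' \in fs -> (k <= s)%N -> (k' <= s)%N ->
     g (f, k) = g (f', k') -> (f, k) = (f', k')) ->
  forall f k, f \in fs -> (k <= s)%N -> size (g (f, k)) = size f.
Proof.
move=> pr_p le_sr fs_uniq fsP DQ szQ Gp0 szG gP g_inj f k f_fs leks.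
pose idx := [seq (f, k) | f <- fs, k <- iota 0 s.+1].
have idxP x : x \in idx -> x.1 \in fs /\ (x.2 <= s)%N.
  by case/allpairsP => -[f' k'] [f'_fs]; rewrite mem_iota add0n ltnS => /andP[_ lek's] ->.
have idx_uniq : uniq idx by rewrite allpairs_uniq ?iota_uniq // => -[? ?] [? ?].
pose e (x : {poly 'F_p} * nat) := ram_index p r s x.2.
have dvG : \prod_(x <- idx) g x ^+ e x %| Gp.
  apply: dvdp_prod_irreducibleX => //.
    by move=> [f1 k1] [f2 k2] /idxP[/= ? ?] /idxP[/= ? ?]; apply: g_inj.
  by case=> f1 k1 /idxP[/= f1_fs lek1]; have [] := gP f1 k1 f1_fs lek1.
(* The default 1 makes the family monic everywhere, as [size_prod_monicX] demands. *)
pose gi x := if x \in idx then g x else 1.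
have gi_mon x : gi x \is monic.
  rewrite /gi; case: ifP => [|_]; last exact: monic1.
  by case: x => f1 k1 /idxP[/= f1_fs lek1]; have [] := gP f1 k1 f1_fs lek1.
pose fi f := if f \in fs then f else 1.
have fi_mon f' : fi f' \is monic.
  by rewrite /fi; case: ifP => [/fsP[] // | _]; exact: monic1.
have sumG : (\sum_(x <- idx) e x * (size (gi x)).-1 <= u * p ^ r)%N.
  rewrite -(size_prod_monicX _ _ gi_mon) -ltnS (leq_trans _ szG) //.
  have -> : \prod_(x <- idx) gi x ^+ e x = \prod_(x <- idx) g x ^+ e x.
    by apply: eq_big_seq => x; rewrite /gi => ->.
  rewrite (leq_trans _ (dvdp_leq Gp0 dvG)) // prednK // size_poly_gt0.
  by apply: dvdpN0 dvG Gp0.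
have sumF : (\sum_(x <- idx) e x * (size x.1).-1 = u * p ^ r)%N.
  rewrite big_allpairs /= /e /=.
  transitivity (\sum_(f' <- fs) 1 * (size (fi f')).-1 * p ^ r)%N.
    apply: eq_big_seq => f'; rewrite /fi => ->; rewrite -big_distrl /= sum_ram_index ?prime_gt0 //.
    by rewrite mul1n mulnC.
  rewrite -big_distrl /= -(size_prod_monicX _ (fun=> 1%N) fi_mon); congr (_ * _)%N.
  rewrite (_ : \prod_(i <- fs) _ = Q) ?szQ // DQ.
  by apply: eq_big_seq => f'; rewrite /fi expr1 => ->.
have idx_fk : (f, k) \in idx.
  by apply/allpairsP; exists (f, k); rewrite mem_iota add0n ltnS.
have le_e x : x \in idx -> (e x * (size x.1).-1 <= e x * (size (gi x)).-1)%N.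
  move=> x_idx; rewrite leq_mul2l /gi x_idx; apply/orP; right.
  move: x_idx; case: x => f1 k1 /idxP[/= f1_fs lek1]; have [_ _ le_sz _] := gP f1 k1 f1_fs lek1.
  by move: le_sz; case: (size f1) => // a; case: (size _).
have /= := leq_sum_seq_eq le_e _ idx_fk; rewrite sumF sumG => /(_ isT)/eqP.
rewrite /gi idx_fk eqn_mul2l => /orP[/eqP e0 | /eqP szE].
  have p_gt0 := prime_gt0 pr_p; have p_gt1 := prime_gt1 pr_p.
  by move: e0; rewrite /e /ram_index /=; case: ifP => _ /eqP; rewrite ?muln_eq0 expn_eq0; lia.
have [_ g_irr _ _] := gP f k f_fs leks; have [_ f_irr] := fsP f f_fs.
have sz_g : (1 < size (g (f, k)))%N := irredp_gt1 g_irr.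
have sz_f : (1 < size f)%N := irredp_gt1 f_irr.
by rewrite -(prednK (ltnW sz_g)) -(prednK (ltnW sz_f)) szE.
Qed.

(** Restricted to the factors [f] of degree [d], [(f, k) |-> g (f, k)] is an injection into the
    monic irreducible polynomials of degree [d]. *)
Lemma Np_ge (p d u s : nat) (m : int) (fs : seq {poly 'F_p})
    (g : {poly 'F_p} * nat -> {poly 'F_p}) :
  'X^u - ((m%:~R : 'F_p)%:P) = \prod_(f <- fs) f ->
  {in fs, forall f, f \is monic /\ irreducible_poly f} ->
  (forall f k, f \in fs -> (k <= s)%N ->
     [/\ g (f, k) \is monic, irreducible_poly (g (f, k)) & size (g (f, k)) = size f]) ->
  (forall f k f' k', f \in fs -> f' \in fs -> (k <= s)%N -> (k' <= s)%N ->
     g (f, k) = g (f', k') -> (f, k) = (f', k')) ->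
  (s.+1 * Npum p d u m <= Np p d)%N.
Proof.
move=> DQ fsP gP g_inj; rewrite /Npum; set A := [set c | _].
have AP c : c \in A -> monic_of c \in fs.
  rewrite inE => /andP[/asboolP c_irr]; rewrite DQ.
  by apply: irreducible_dvdp_prod => //; apply: monic_of_monic.
pose phi (x : {ffun 'I_d -> 'F_p} * 'I_s.+1) := [ffun i : 'I_d => (g (monic_of x.1, val x.2))`_i].
have phiK c (k : 'I_s.+1) : c \in A -> monic_of (phi (c, k)) = g (monic_of c, val k).
  move=> /AP c_fs; have [g_mon _ g_sz] := gP _ k c_fs (ltn_ord k).
  by rewrite monic_ofE // g_sz size_monic_of.
have -> : (s.+1 * #|A| = #|setX A [set: 'I_s.+1]|)%N by rewrite cardsX cardsT card_ord mulnC.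
rewrite -(card_in_imset (f := phi)); last first.
  move=> [c k] [c' k'] /setXP[/= cA _] /setXP[/= c'A _] /(congr1 (@monic_of p d)).
  rewrite !phiK // => /(g_inj _ _ _ _ (AP _ cA) (AP _ c'A) (ltn_ord k) (ltn_ord k')).
  by case=> /monic_of_inj -> /val_inj ->.
apply/subset_leq_card/subsetP => _ /imsetP[[c k] /setXP[/= cA _] ->].
rewrite inE phiK //; apply/asboolP.
by have [] := gP _ k (AP _ cA) (ltn_ord k).
Qed.

Theorem theorem2p1 (n : nat) (m : int) (u r p : nat) (alpha : algC) :
  (3 <= n)%N ->
  m != 0 -> m != 1 -> m != -1 ->
  irreducible_poly ('X^n - (m%:~R)%:P : {poly rat}) ->
  alpha ^+ n = m%:~R ->
  (0 < u)%N -> n = (u * p ^ r)%N ->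
  prime p -> odd p -> ~~ ((p : int) %| (u%:Z * m))%Z ->
  (exists d : nat, (0 < d)%N /\
     (Np p d < minn r.+1 (nu_p p (m ^+ p.-1 - 1)) * Npum p d u m)%N) ->
  ~ monogenic alpha.
Proof.
move=> n_ge3 _ _ _ F_irr Dm u_gt0 Dn pr_p p_odd p_um [d [_ ltN]] mono.
have [p_u p_m] : ~~ (p %| u)%N /\ ~~ (p %| m)%Z.
  by move: p_um; rewrite !dvdzE abszM Euclid_dvdM // negb_or => /andP[].
have n_gt0 : (0 < n)%N by apply: leq_trans n_ge3.
move: ltN; set nu := nu_p _ _ => ltN.
have nu_gt0 : (0 < nu)%N by case: (posnP nu) ltN => // ->; rewrite minn0 mul0n.
pose s := (minn r nu.-1)%N.
have Ds : minn r.+1 nu = s.+1 by rewrite /s -minnSS prednK.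
(* [logn p 0] is 0, so [M = 1] would give [nu = 0], which the strict inequality excludes. *)
have M1 : m ^+ p.-1 != 1.
  by apply: contraTneq nu_gt0 => M1; rewrite /nu /nu_p M1 subrr absz0 logn0.
have pX_M j : (p%:Z ^+ j %| m ^+ p.-1 - 1)%Z = (j <= nu)%N.
  by rewrite dvdzE abszX /= pfactor_dvdn // absz_gt0 subr_eq0.
have le_sr : (s <= r)%N by apply: geq_minl.
have pM : (p%:Z ^+ s.+1 %| m ^+ p.-1 - 1)%Z by rewrite pX_M -Ds geq_minr.
(* If [s < r] then [s = nu - 1], and [s + 2] exceeds [nu]. *)
have pM_max : (s < r)%N -> ~ (p%:Z ^+ s.+2 %| m ^+ p.-1 - 1)%Z.
  have minE (a b : nat) : (0 < b -> minn a b.-1 < a -> ~ (minn a b.-1).+2 <= b)%N.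
    by case: b => // b _; rewrite /minn; case: ifP => _; rewrite ltnn.
  by rewrite pX_M => lt_sr; apply: minE nu_gt0 lt_sr.
have F_alpha : root (map_poly ratr ('X^n - (m%:~R)%:P : {poly rat})) alpha.
  by rewrite rmorphB /= map_polyXn map_polyC /= ratr_int rootE !hornerE Dm subrr.
have F_gt1 : (1 < size ('X^n - (m%:~R)%:P : {poly rat})%R)%N := irredp_gt1 F_irr.
have [theta [G [theta_in theta_gen G_mon G0 G_min] szG]] :=
  monogenic_generator F_gt1 F_alpha mono.
rewrite size_XnsubC // in szG.
pose Q := 'X^u - (m%:~R : 'F_p)%:P.
have Q_mon : Q \is monic by apply: monicXnsubC.
have Q_sep : separable_poly Q.
  apply: separable_Xn_subC; last by rewrite (intr_Fp_eq0 pr_p).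
  by rewrite -(dvdn_pcharf (pchar_Fp pr_p)).
have [fs [fs_uniq fsP DQ]] := separable_factorization Q_mon Q_sep.
(* The range conditions are premises inside [good], so that choice yields a total function, with
   value unconstrained off the range. *)
pose good (x : {poly 'F_p} * nat) (h : {poly 'F_p}) := x.1 \in fs -> (x.2 <= s)%N ->
  [/\ h \is monic, irreducible_poly h, h %| redp p G & prime_class u r s alpha theta h x.1 x.2].
have /choice[g gP] : forall x, exists h, good x h.
  case=> f k; case: (boolP (f \in fs)) => [f_fs | nf]; last by exists 0; rewrite /good /= (negPf nf).
  have [lek | nk] := boolP (k <= s)%N; last by exists 0; rewrite /good /= (negPf nk).
  have [_ f_irr] := fsP f f_fs.
  have fQ : f %| Q by rewrite DQ (big_rem f) //= dvdp_mulr.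
  have [h hP] := class_exists pr_p p_odd u_gt0 p_u p_m Dn Dm F_irr M1 le_sr pM theta_in theta_gen
    G_mon G0 G_min f_irr fQ lek.
  by exists h.
have g_inj f k f' k' : f \in fs -> f' \in fs -> (k <= s)%N -> (k' <= s)%N ->
    g (f, k) = g (f', k') -> (f, k) = (f', k').
  move=> f_fs f'_fs lek lek' gg.
  have [_ g_irr gG gfk] := gP (f, k) f_fs lek; have [_ _ _ gfk'] := gP (f', k') f'_fs lek'.
  have [f_mon f_irr] := fsP f f_fs; have [f'_mon f'_irr] := fsP f' f'_fs.
  rewrite -gg in gfk'.
  by have [/= -> ->] := class_unique pr_p p_odd u_gt0 Dn Dm M1 le_sr pM theta_gen G_min
    g_irr gG f_mon f_irr f'_mon f'_irr lek lek' gfk gfk'.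
have Gp0 : redp p G != 0 := redG_neq0 p G_mon.
have g_size f k : f \in fs -> (k <= s)%N -> size (g (f, k)) = size f.
  apply: (class_size_eq (u := u) (r := r) pr_p le_sr fs_uniq fsP DQ _ Gp0 _ _ g_inj).
  - by rewrite size_XnsubC.
  - by rewrite -Dn (leq_trans (size_poly _ _)).
  - move=> f' k' f'_fs lek'; have [g_mon g_irr gG gfk] := gP (f', k') f'_fs lek'.
    have [f'_mon f'_irr] := fsP f' f'_fs; split=> //.
      exact: (class_size pr_p u_gt0 Dn Dm theta_gen G_min g_irr gG gfk f'_irr).
    exact: (class_multiplicity pr_p p_odd u_gt0 Dn Dm M1 le_sr pM theta_in theta_gen
      G_mon G0 G_min pM_max g_irr gG lek' gfk).
have := @Np_ge p d u s m fs g DQ fsP _ g_inj; rewrite leqNgt -Ds ltN => /(_ _)/negP; apply=> //.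
move=> f k f_fs lek; have [g_mon g_irr _ _] := gP (f, k) f_fs lek.
by split=> //; apply: g_size.
Qed.
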